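(* Let $G$ be a connected simple graph on the vertex set $\{1,\ldots,n\}$. Suppose that $G$ is bipartite with exactly one cycle $C$, and let $H$ be the graph associated to $G$ obtained by gluing to the twisted prism $\overline{C}$ of $C$ the prisms of the trees attached to $C$ (defined in the context). Then the universal Gröbner basis of $P_{G}$ is given by the set $$U(P_{G})=\{B_{\Gamma} \mid \Gamma \text{ is an even cycle of } H\}.$$
   Context: $K$ is a field. A simple graph is a finite undirected graph without loops or multiple edges. For a simple graph $G$ on $\{1,\ldots,n\}$ with $m$ edges, let $S=K[\{x_{ij},x_{ji} : \{i,j\}\in E(G)\}\cup\{x_{ii}\}_{1\le i\le n}]$. For $i<j$ put $f_{ij}=x_{ii}x_{jj}-x_{ij}x_{ji}$; $P_G\subset S$ is the ideal generated by all $f_{ij}$ with $\{i,j\}\in E(G)$. The universal Gröbner basis $U(I)$ of an ideal generated by binomials is the union of all its reduced Gröbner bases (over all term orders); binomials are identified up to sign. Cycles: a cycle of length $l\ge 3$ is a closed walk $(\{u_1,u_2\},\{u_2,u_3\},\ldots,\{u_l,u_1\})$ with $u_1,\ldots,u_l$ distinct; it is even if $l$ is even. ''Exactly one cycle'' means exactly one as a subgraph. The graph $H$: let $C=(\{c_1,c_2\},\{c_2,c_3\},\ldots,\{c_k,c_1\})$ be the unique cycle of $G$, where $k\ge4$ is even. (i) The twisted prism $\overline{C}$ has the $2k$ distinct vertices $v_r,w_r$ ($r\in\{c_1,\ldots,c_k\}$) and the $3k$ edges: $z_{rr}=\{v_r,w_r\}$ for every vertex $r$ of $C$; $z_{rs}=\{v_r,v_s\}$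 and $z_{sr}=\{w_r,w_s\}$ for $r=c_j$, $s=c_{j+1}$, $1\le j\le k-1$; and, for $r=c_1$, $s=c_k$, $z_{rs}=\{v_r,w_s\}$ and $z_{sr}=\{v_s,w_r\}$. (ii) $G$ is obtained from $C$ by attaching pairwise disjoint trees $T_1,\ldots,T_s$ at vertices $i_1,\ldots,i_s$ of $C$ (so $V(T_j)\cap V(C)=\{i_j\}$). The prism $T_j^{\star}$ of $T_j$ has the distinct vertices $p_r,q_r$ ($r\in V(T_j)$), the edges $z_{rr}=\{p_r,q_r\}$ for $r\in V(T_j)$, and the edges $z_{rs}=\{p_r,p_s\}$, $z_{sr}=\{q_r,q_s\}$ for every edge $\{r,s\}$ of $T_j$ with $r<s$. (iii) $H$ is the union of $\overline{C}$ and $T_1^\star,\ldots,T_s^\star$ after identifying $p_{i_j}=v_{i_j}$ and $q_{i_j}=w_{i_j}$ for $1\le j\le s$ (so that $T_j^\star\cap\overline{C}$ is the single edge $z_{i_ji_j}$ with its two vertices) and with the $T_j^{\star}$ pairwise vertex-disjoint. The edges of $H$ are thus labelled $z_{ab}$, in bijection with the variables $x_{ab}$ of $S$. For an even cycle $\Gamma$ of $H$ with consecutive edges $g_1,\ldots,g_{2l}$, and with $x(g)$ denoting the variable $x_{ab}$ corresponding to the edge $g=z_{ab}$, put $B_\Gamma=\prod_{j=1}^{l}x(g_{2j-1})-\prod_{j=1}^{l}x(g_{2j})\in S$ (well defined up to sign). *)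

(* Defs.v *)
From mathcomp Require Import all_boot all_order all_algebra.
From mathcomp Require Import mpoly.

Set Implicit Arguments.
Unset Strict Implicit.
Unset Printing Implicit Defensive.

Import GRing.Theory.
Local Open Scope ring_scope.

(** * Ideals and universal Groebner bases in [{mpoly K[N]}] *)

Section Groebner.
Variables (K : fieldType) (N : nat).
Local Notation S := {mpoly K[N]}.

Definition ideal_gen (A : S -> Prop) (p : S) : Prop :=
  exists2 s : seq (S * S),
    (forall x, x \in s -> A x.2) & p = \sum_(x <- s) x.1 * x.2.

Definition term_order (le : rel 'X_{1..N}) : Prop :=
  [/\ total le, antisymmetric le, transitive le,
      (forall m, le 0%MM m) &
      (forall m m1 m2, le m1 m2 -> le (m + m1)%MM (m + m2)%MM)].

(* False for every [m] when [p = 0]. *)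
Definition is_lead (le : rel 'X_{1..N}) (p : S) (m : 'X_{1..N}) : Prop :=
  m \in msupp p /\ (forall m', m' \in msupp p -> le m' m).

Definition initial_ideal (le : rel 'X_{1..N}) (A : S -> Prop) : S -> Prop :=
  ideal_gen (fun q => exists p m, [/\ A p, is_lead le p m & q = 'X_[m]]).

Definition groebner_basis (le : rel 'X_{1..N}) (I : S -> Prop) (B : seq S) :=
  (forall g, g \in B -> I g) /\
  (forall p, initial_ideal le I p <-> initial_ideal le (fun g => g \in B) p).

(* The first clause makes every element of [B] nonzero and monic. *)
Definition reduced_groebner_basis
    (le : rel 'X_{1..N}) (I : S -> Prop) (B : seq S) : Prop :=
  [/\ groebner_basis le I B,
      (forall g, g \in B -> exists2 m, is_lead le g m & g@_m = 1) &
      (forall g h m m', g \in B -> h \in B -> g != h ->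
         m \in msupp g -> is_lead le h m' -> ~~ (m' <= m)%MM)].

Definition universal_groebner_basis (I : S -> Prop) (p : S) : Prop :=
  exists le B, [/\ term_order le, reduced_groebner_basis le I B & p \in B].

Definition up_to_sign (A : S -> Prop) (p : S) : Prop := A p \/ A (- p).

End Groebner.

(** * Graphs and cycles *)

Section Cycles.
Variable T : finType.
Implicit Type (e : rel T) (u : seq T).

Definition connected_graph e : Prop := forall x y, connect e x y.

Definition bipartite e : Prop :=
  exists f : T -> bool, forall x y, e x y -> f x != f y.

(* A cycle is given by its vertices [u_1, ..., u_l]. *)
Definition is_cycle e u : bool := [&& 2 < size u, uniq u & cycle e u]%N.

(* [{u_1,u_2}, {u_2,u_3}, ..., {u_l,u_1}] *)
Definition cycle_edges u : seq {set T} :=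
  [seq [set p.1; p.2] | p <- zip u (rot 1 u)].

(* The same subgraph is enumerated by several vertex sequences. *)
Definition unique_cycle e u : Prop :=
  is_cycle e u /\
  (forall u', is_cycle e u' -> cycle_edges u' =i cycle_edges u).

End Cycles.

(** * The graph H *)

(* [v_r] and [w_r]; for the prism of a tree, [p_r := v_r] and [q_r := w_r], so
   that taking unions of edge sets performs the gluing. *)
Definition vtx n (r : 'I_n) : 'I_n * bool := (r, false).
Definition wtx n (r : 'I_n) : 'I_n * bool := (r, true).

(* [((a, b), g)] stands for an edge [g] labelled [z_ab]. *)
Definition labelled_edge n := ('I_n * 'I_n * {set 'I_n * bool})%type.

Section GraphH.
Variables (n : nat) (e : rel 'I_n).
Implicit Type (c : seq 'I_n).

Definition rungs (V : {set 'I_n}) : {set labelled_edge n} :=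
  [set ((r, r), [set vtx r; wtx r]) | r in V].

Definition twisted_prism c : {set labelled_edge n} :=
  rungs [set r in c]
  :|: [set ((p.1, p.2), [set vtx p.1; vtx p.2]) | p in zip c (behead c)]
  :|: [set ((p.2, p.1), [set wtx p.1; wtx p.2]) | p in zip c (behead c)]
  :|: (if c is r :: c' then let s := last r c' in
         [set ((r, s), [set vtx r; wtx s]); ((s, r), [set vtx s; wtx r])]
       else set0).

(* The prism of the tree with vertex set [V] and adjacency [t] on [V]. *)
Definition prism (V : {set 'I_n}) (t : rel 'I_n) : {set labelled_edge n} :=
  rungs V
  :|: [set ((p.1, p.2), [set vtx p.1; vtx p.2])
        | p : 'I_n * 'I_n in setX V V & (t p.1 p.2 && (p.1 < p.2)%N)]
  :|: [set ((p.2, p.1), [set wtx p.1; wtx p.2])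
        | p : 'I_n * 'I_n in setX V V & (t p.1 p.2 && (p.1 < p.2)%N)].

(* The tree attached to the cycle [c] at its vertex [i] is the connected
   component of [i] once the edges of [c] are removed; it is reduced to [i] when
   nothing is attached there, and its prism is then already in
   [twisted_prism c]. *)
Definition off_cycle c : rel 'I_n :=
  [rel r s | e r s && ([set r; s] \notin cycle_edges c)].

Definition tree_vertices c (i : 'I_n) : {set 'I_n} :=
  [set r | connect (off_cycle c) i r].

Definition graphH c : {set labelled_edge n} :=
  twisted_prism c
  :|: \bigcup_(i in [set i in c]) prism (tree_vertices c i) (off_cycle c).

Definition adjH c : rel ('I_n * bool) :=
  [rel x y | [exists z in graphH c, z.2 == [set x; y]]].

End GraphH.

(** * The ring S, the ideal P_G and the binomials B_Gamma *)

(* The indices of the variables: edges in both directions, and the diagonal. *)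
Definition varidx n (e : rel 'I_n) : finType :=
  {p : 'I_n * 'I_n | (p.1 == p.2) || e p.1 p.2}.

Definition polyS (K : fieldType) n (e : rel 'I_n) :=
  {mpoly K[#|varidx e|]}.

Section PG.
Variables (K : fieldType) (n : nat) (e : rel 'I_n).

(* [x_ab]; the value 0 outside the index set is never used. *)
Definition xvar (a b : 'I_n) : polyS K e :=
  if insub (a, b) is Some i then 'X_(enum_rank (i : varidx e)) else 0.

Definition fgen (i j : 'I_n) : polyS K e :=
  xvar i i * xvar j j - xvar i j * xvar j i.

Definition PG : polyS K e -> Prop :=
  ideal_gen (fun p => exists i j : 'I_n, [/\ (i < j)%N, e i j & p = fgen i j]).

(* [x(g) = x_ab] for the edge [g = z_ab] of H; 0 if [g] is not an edge of H. *)
Definition xedge (c : seq 'I_n) (g : {set 'I_n * bool}) : polyS K e :=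
  if [pick z in graphH e c | z.2 == g] is Some z then xvar z.1.1 z.1.2 else 0.

(* Indices start at 0 here, hence the first product runs over even ones. *)
Definition cycle_binomial (c : seq 'I_n) (u : seq ('I_n * bool)) : polyS K e :=
  let g := cycle_edges u in
  \prod_(j < size g | ~~ odd j) xedge c (nth set0 g j)
  - \prod_(j < size g | odd j) xedge c (nth set0 g j).

End PG.

(* Main.v *)
Require Import Defs.
From mathcomp Require Import all_boot all_order all_algebra zify.
From mathcomp Require Import mpoly.

Set Implicit Arguments.
Unset Strict Implicit.
Unset Printing Implicit Defensive.

Import GRing.Theory.

(** Give a monomial of S the degree which records, at each vertex of H, the
    number of its variables (with multiplicity) whose edges of H contain that
    vertex.  The proof rests on three facts about this degree.

    The ideal P_G is the toric ideal of H: it is the span of the binomials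
    X^m - X^m' with m and m' of equal degree.  The generators are such
    binomials because the edges z_rr, z_ss, z_rs, z_sr form a square
    ([square_degrees], [toric_map_PG]).  Conversely, modulo P_G every monomial
    can be rewritten so that it never contains both x_rs and x_sr.  The
    difference of the exponents of x_rs and x_sr is a function of the degree:
    the homogeneous linear system which governs it is the signed incidence
    system of G, where only the twisted edge has the unusual sign, and it has
    only the zero solution because the single cycle of G is even
    ([edge_functional]).  So a rewritten monomial is determined by its degree
    ([normal_form_unique], [binomial_PG]).

    Two distinct monomials u and v of equal degree always contain an even cycle
    of H whose edges lie alternately in u and in v ([conformal_cycle]).  Colour
    the edges that u contains more often red, and those that v contains more
    often blue; every vertex on a red edge is on a blue one, so there are closed
    alternating walks.  A shortest one can visit a vertex twice only if the
    vertex cuts it into two odd closed walks with no further common vertex.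
    This is impossible in H, where two odd closed walks share at least two
    vertices ([odd_walks_share]): by a parity argument each of them crosses over
    every edge of C, and if they avoided each other they would have to stay on
    opposite sides of the prism all the way round, which the twist forbids.

    The binomials of even cycles are circuits: no even cycle has its edges among
    those of another one ([alt_mon_circuit]).  From these facts the theorem is
    formal ([universal_groebner_basis_circuits]).  For a given order
    the initial ideal is generated by the leads of cycle binomials, and the
    reduced basis consists of those cycle binomials whose lead is a minimal
    generator and whose other monomial is standard.  An order which makes all
    variables outside a cycle large puts the binomial of that cycle in its
    reduced basis. *)

(** * Alternating closed walks *)

Lemma not_uniq_map (S T : eqType) (f : S -> T) (s : seq S) :
  ~~ uniq (map f s) ->
  exists s1 x s2 y s3, s = s1 ++ x :: s2 ++ y :: s3 /\ f x = f y.
Proof.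
elim: s => //= x s IHs; rewrite negb_and negbK => /orP[/mapP[y ys fxy]|/IHs].
  have [s2 s3] := splitPr ys; by exists [::], x, s2, y, s3.
move=> [s1 [z [s2 [y [s3 [-> fzy]]]]]].
by exists (x :: s1), z, s2, y, s3.
Qed.

Lemma cycle_split (T : eqType) (e : rel T) s1 x s2 y s3 :
  cycle e (s1 ++ x :: s2 ++ y :: s3) ->
  path e x (rcons s2 y) /\ path e y (rcons (s3 ++ s1) x).
Proof.
rewrite -(rot_cycle (size s1)) rot_size_cat /= -!catA cat_cons rcons_cat /=.
by rewrite -cat_rcons cat_path last_rcons rcons_cat -?catA => /andP[].
Qed.

(** In this section [R false] and [R true] are the red and the blue edges of a
    graph [adj].  The last hypothesis is the one property of the graph that
    makes closed alternating walks contain alternating cycles. *)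
Section AlternatingWalks.
Variables (T : finType) (adj : rel T) (R : bool -> rel T).
Hypothesis R_sym : forall b, ssrbool.symmetric (R b).
Hypothesis R_adj : forall b, subrel (R b) adj.
Hypothesis R_disjoint : forall b x y, R b x y -> ~~ R (~~ b) x y.
Hypothesis R_progress : forall b x y, R b x y -> exists z, R (~~ b) y z.
Hypothesis odd_walks_meet : forall w1 w2 : seq T,
  cycle adj w1 -> cycle adj w2 -> odd (size w1) -> odd (size w2) ->
  exists x y, [/\ x != y, x \in w1, y \in w1, x \in w2 & y \in w2].

(** A state [(x, b)] is a vertex with the colour of the edge about to be taken.
    A closed alternating walk is then an ordinary cycle of this directed graph,
    and walking backwards amounts to [flip]. *)
Definition alt_step : rel (T * bool) :=
  fun s t => (t.2 == ~~ s.2) && R s.2 s.1 t.1.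

Definition flip (s : T * bool) := (s.1, ~~ s.2).

Lemma flipK : involutive flip.
Proof. by case=> x b; rewrite /flip /= negbK. Qed.

Lemma alt_step_flip s t : alt_step s t -> alt_step (flip t) (flip s).
Proof.
case: s t => [x b] [y c] /andP[/= /eqP-> Rxy].
by rewrite /alt_step /= !negbK eqxx R_sym.
Qed.

Lemma eq_or_flip s t : s.1 = t.1 -> s != t -> t = flip s.
Proof. by case: s t => [x b] [y c] /= ->; rewrite xpair_eqE eqxx /flip /=; case: b; case: c. Qed.

Lemma alt_path_color s p :
  path alt_step s p -> (last s p).2 = s.2 (+) odd (size p).
Proof.
elim: p s => [|t p IHp] s /=; first by rewrite addbF.
by move=> /andP[/andP[/eqP tE _] /IHp->]; rewrite tE addbN addNb.
Qed.

Lemma alt_path_adj s p : path alt_step s p -> path adj s.1 (map fst p).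
Proof.
rewrite path_map; apply: sub_path => a b /andP[_]; exact: R_adj.
Qed.

Lemma alt_path_rev s p t : path alt_step s (rcons p t) ->
  path alt_step (flip t) (rcons (rev (map flip p)) (flip s)).
Proof.
move=> Dp.
have -> : rcons (rev (map flip p)) (flip s) = rev (belast (flip s) (map flip (rcons p t))).
  by rewrite map_rcons belast_rcons rev_cons.
have -> : flip t = last (flip s) (map flip (rcons p t)) by rewrite last_map last_rcons.
rewrite rev_path path_map; apply: sub_path Dp => a b; exact: alt_step_flip.
Qed.

(** Returning to a vertex in the other state takes an odd number of steps,
    since the colour changes at each step. *)
Lemma alt_closed_odd s p t : path alt_step s (rcons p t) -> t = flip s ->
  cycle adj (map fst (s :: p)) /\ odd (size (map fst (s :: p))).
Proof.
move=> Dp tE; split.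
  have := alt_path_adj Dp; rewrite map_rcons tE; by [].
have := alt_path_color Dp; rewrite last_rcons tE /= size_rcons size_map /=.
by case: (s.2); case: (odd _).
Qed.

(** A closed alternating walk through a vertex in both states splits there into
    two odd closed walks.  These share another vertex, which is again visited in
    both states: the walk reads [a A1 b A2 (flip a) C1 (flip b) C2].  The part
    [a A1 b], followed by [C1] reversed and flipped, is a shorter one. *)
Lemma shorten_alt_cycle s : cycle alt_step s -> s != [::] ->
  exists s', [/\ cycle alt_step s', s' != [::] & uniq (map fst s')].
Proof.
have [k] := ubnP (size s); elim: k => // k IHk in s * => bound Ds s0.
have [us|nus] := boolP (uniq (map fst s)); first by exists s.
have [uS|nuS] := boolP (uniq s); last first.
  rewrite -[s]map_id in nuS; have [s1 [x [s2 [y [s3 [sE xy]]]]]] := not_uniq_map nuS.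
  rewrite -xy {y xy} in sE; rewrite sE in Ds bound; have [Dx _] := cycle_split Ds.
  apply: (IHk (x :: s2)) => //.
  by move: bound; rewrite !size_cat /= !size_cat /=; lia.
have [s1 [a [A [c [s3 [sE ac]]]]]] := not_uniq_map nus.
rewrite {}sE in Ds uS bound {nus s0}.
have [DA DC] := cycle_split Ds; set C := s3 ++ s1 in DC.
have {}bound : (size A + size C).+1 < k.
  by move: bound; rewrite /C !size_cat /= !size_cat /=; lia.
have {}uS : uniq (a :: A ++ c :: C).
  by move: uS; rewrite -(rot_uniq (size s1)) rot_size_cat /= -catA.
have cE : c = flip a.
  by apply: eq_or_flip => //; move: uS => /= /andP[]; move=> aN _; apply: contraNN aN => /eqP->;
    rewrite mem_cat mem_head orbT.
have [cycA oddA] := alt_closed_odd DA cE.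
have aE : a = flip c by rewrite cE flipK.
have [cycC oddC] := alt_closed_odd DC aE.
have [q [qa qA qC]] : exists q, [/\ q != a.1, q \in map fst (a :: A) & q \in map fst (c :: C)].
  have [x [y [xy xA yA xC yC]]] := odd_walks_meet cycA cycC oddA oddC.
  by have [xa|xa] := eqVneq x a.1; [exists y; rewrite -xa eq_sym|exists x].
rewrite in_cons (negPf qa) /= in qA; rewrite in_cons -ac (negPf qa) /= in qC.
case/mapP: qA => b bA qb; case/mapP: qC => g gC qg.
have gE : g = flip b.
  apply: eq_or_flip; first by rewrite -qb.
  apply: contraTneq uS => bg; rewrite bg in bA.
  rewrite cons_uniq cat_uniq; apply/negP => /and4P[_ _ /hasPn/(_ g) + _].
  by rewrite inE gC orbT bA => /(_ isT).
case/splitPr: bA DA bound {cycA oddA uS} => A1 A2 DA bound.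
case/splitPr: gC DC bound {cycC oddC} => C1 C2 DC bound.
apply: (IHk (a :: A1 ++ b :: rev (map flip C1))) => //.
  by move: bound; rewrite /= !size_cat /= size_rev size_map; lia.
rewrite /= rcons_cat cat_path /=.
move: DA; rewrite rcons_cat cat_path /= => /and3P[-> -> _] /=.
move: DC; rewrite rcons_cat -cat_rcons cat_path => /andP[/alt_path_rev + _].
by rewrite gE flipK aE.
Qed.

(** By progress, the walk can always be continued; following a fixed choice of
    continuations among finitely many states, it eventually repeats one. *)
Lemma alt_cycle_exists b x y : R b x y ->
  exists s, cycle alt_step s /\ s != [::].
Proof.
move=> Rxy; pose f (s : T * bool) := (odflt s.1 [pick z | R s.2 s.1 z], ~~ s.2).
pose active (s : T * bool) := [exists z, R s.2 s.1 z].
have fP s : active s -> alt_step s (f s) /\ active (f s).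
  move=> /existsP[z Rz]; rewrite /alt_step /f /active /=; case: pickP => [t Rt|/(_ z)];
    last by rewrite Rz.
  by rewrite eqxx Rt; split=> //=; apply/existsP; apply: R_progress Rt.
have act k s : active s -> active (iter k f s).
  by move=> act_s; elim: k => //= k /fP[].
have trajP k s : active s -> path alt_step s (traject f (f s) k).
  by elim: k s => //= k IHk s /fP[-> /IHk].
have axb : active (x, b) by apply/existsP; exists y.
have /trajectP[i lt_in iE] := looping_order f (x, b).
set n := order f _ in lt_in iE; set s := iter i f (x, b) in iE.
have [k kE] : exists k, n = (i + k.+1)%N by exists (n - i.+1)%N; rewrite addnS -addSn subnKC.
exists (traject f s k.+1); split=> //=.
have fs : iter k f (f s) = s by rewrite -iterSr /s -iterD addnC -kE.
rewrite -[X in rcons _ X]fs -trajectSr; apply: trajP; exact: act.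
Qed.

(** The cycle is rotated so that its first edge is red. *)
Lemma alternating_cycle_exists b x y : R b x y ->
  exists z p, [/\ uniq (z :: p), 2 < size (z :: p), ~~ odd (size (z :: p)) &
    forall j, j < size (z :: p) -> R (odd j) (nth z (z :: p) j) (nth z (rcons p z) j)].
Proof.
move=> /alt_cycle_exists[s [Ds s0]].
have [{Ds s0}s [Ds s0 us]] := shorten_alt_cycle Ds s0.
wlog sb : s Ds s0 us / ~~ (head (x, b) s).2.
  move=> IH; have [sb|sb] := boolP (head (x, b) s).2; last exact: IH sb.
  apply: (IH (rot 1 s)); rewrite ?rot_cycle ?map_rot ?rot_uniq //.
    by rewrite -size_eq0 size_rot size_eq0.
  case: s {us IH} Ds s0 sb => [|t [|t' s]] //=; rewrite /rot /=.
    by rewrite /alt_step; case: (t.2).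
  by move=> /andP[/andP[/eqP-> _] _] _ ->.
case: s Ds s0 us sb => [|s p] // Ds _ us sb.
have colors j : j < size (s :: p) -> (nth s (s :: p) j).2 = odd j.
  elim: j => [|j IHj] lt_j /=; first by apply/negbTE.
  move/(pathP s)/(_ j): Ds; rewrite size_rcons nth_rcons => /(_ (ltnW lt_j)).
  have ltj : j < size p by [].
  by rewrite ltj => /andP[/eqP-> _]; have lt_j' := ltnW lt_j;
    rewrite -rcons_cons nth_rcons lt_j' IHj.
have size_even : ~~ odd (size (s :: p)).
  have := alt_path_color Ds; rewrite last_rcons size_rcons /=.
  by case: (s.2); case: (odd _).
exists s.1, (map fst p); rewrite /= size_map.
have steps j : j < (size p).+1 ->
    R (odd j) (nth s.1 (s.1 :: map fst p) j) (nth s.1 (rcons (map fst p) s.1) j).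
  move=> lt_j; move/(pathP s)/(_ j): Ds; rewrite size_rcons => /(_ lt_j) /andP[_].
  rewrite -rcons_cons [nth s (rcons _ _) j]nth_rcons lt_j colors // -map_rcons -map_cons (nth_map
    s) ?size_rcons //.
  by rewrite (nth_map s) // size_rcons.
split=> //; case: p {Ds us colors sb} steps size_even => [|t [|t' p]] //= steps _.
have := steps 0 isT => /= /R_disjoint; rewrite R_sym.
by have := steps 1 isT; rewrite /= => ->.
Qed.

End AlternatingWalks.

Local Open Scope ring_scope.

(** * Generated ideals and term orders *)

Section IdealGen.
Variables (K : fieldType) (N : nat).
Local Notation S := {mpoly K[N]}.
Implicit Types (A B : S -> Prop) (p q : S).

Lemma ideal_genD A p q : ideal_gen A p -> ideal_gen A q -> ideal_gen A (p + q).
Proof.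
move=> [s As ->] [t At ->]; exists (s ++ t); last by rewrite big_cat.
by move=> x; rewrite mem_cat => /orP[/As|/At].
Qed.

Lemma ideal_genM A p q : ideal_gen A q -> ideal_gen A (p * q).
Proof.
move=> [s As ->]; exists [seq (p * x.1, x.2) | x <- s].
  by move=> _ /mapP[x /As Ax ->].
by rewrite big_map mulr_sumr; apply: eq_bigr => x _ /=; rewrite mulrA.
Qed.

Lemma ideal_gen0 A : ideal_gen A 0.
Proof. by exists [::]; rewrite ?big_nil. Qed.

Lemma ideal_genN A p : ideal_gen A p -> ideal_gen A (- p).
Proof. by move/(ideal_genM (-1)); rewrite mulN1r. Qed.

Lemma ideal_genB A p q : ideal_gen A p -> ideal_gen A q -> ideal_gen A (p - q).
Proof. by move=> Ap /ideal_genN; apply: ideal_genD. Qed.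

Lemma mem_ideal_gen A p : A p -> ideal_gen A p.
Proof.
move=> Ap; exists [:: (1, p)]; last by rewrite big_seq1 mul1r.
by move=> x /[!inE] /eqP->.
Qed.

Lemma ideal_gen_trans A B p :
  (forall q, A q -> ideal_gen B q) -> ideal_gen A p -> ideal_gen B p.
Proof.
move=> AB [s As ->]; elim: s As => [|x s IHs] As; first by rewrite big_nil; apply: ideal_gen0.
rewrite big_cons; apply: ideal_genD; last by apply: IHs => y ys; apply: As; rewrite inE ys orbT.
by apply/ideal_genM/AB/As; rewrite mem_head.
Qed.

(** The initial ideal is a monomial ideal, hence membership of a polynomial is
    visible on each of its monomials. *)
Lemma msupp_initial_ideal le A p m :
  initial_ideal le A p -> m \in msupp p ->
  exists g m', [/\ A g, is_lead le g m' & (m' <= m)%MM].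
Proof.
move=> [s As ->] /msupp_sum_le /flatten_mapP[x].
rewrite mem_filter /= => xs.
have [g [m' [Ag lg ->]]] := As _ xs.
move=> /msuppM_le /allpairsP[[m1 m2] /= [_ /mem_msuppXP <- ->]].
by exists g, m'; split=> //; apply: lem_addl.
Qed.

End IdealGen.

Lemma mdeg_ltm N (a u : 'X_{1..N}) :
  (a <= u)%MM -> a != u -> (mdeg a < mdeg u)%N.
Proof.
move=> /submK <-; rewrite mdegD -[ltnLHS]add0n ltn_add2r lt0n mdeg_eq0.
by apply: contraNneq => ->; rewrite add0m.
Qed.

Section TermOrder.
Variables (N : nat) (le : rel 'X_{1..N}) (le_to : term_order le).
Implicit Types m : 'X_{1..N}.

Lemma term_order_refl m : le m m.
Proof. by case: le_to => tot _ _ _ _; have := tot m m; rewrite orbb. Qed.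

Lemma term_order_anti m m' : le m m' -> le m' m -> m = m'.
Proof. by case: le_to => _ anti _ _ _ mm' m'm; apply: anti; rewrite mm'. Qed.

Lemma term_order_dvd m m' : (m <= m')%MM -> le m m'.
Proof.
case: le_to => _ _ _ le0 leD /submK <-.
by rewrite addmC -{1}[m]addm0; apply: leD.
Qed.

Lemma term_order_cancel m m1 m2 : le (m + m1)%MM (m + m2)%MM -> le m1 m2.
Proof.
case: le_to => tot _ _ _ leD le12; case/orP: (tot m1 m2) => // le21.
by rewrite (addmI (term_order_anti le12 (leD m _ _ le21))) term_order_refl.
Qed.

Lemma term_order_max (s : seq 'X_{1..N}) :
  s != [::] -> exists2 m, m \in s & forall m', m' \in s -> le m' m.
Proof.
case: le_to => tot _ tr _ _.
elim: s => // x [|y s] IHs _.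
  by exists x; rewrite ?mem_head // => m' /[!inE] /eqP->; apply: term_order_refl.
have [//|m ms mmax] := IHs; case/orP: (tot x m) => [lexm|lemx].
  exists m; first by rewrite in_cons ms orbT.
  by move=> m' /[1!in_cons] /predU1P[->|/mmax].
exists x; first exact: mem_head.
by move=> m' /[1!in_cons] /predU1P[->|/mmax lem'm]; [apply: term_order_refl|apply: tr lemx].
Qed.

Lemma term_order_min (s : seq 'X_{1..N}) :
  s != [::] -> exists2 m, m \in s & forall m', m' \in s -> le m m'.
Proof.
case: le_to => tot _ tr _ _.
elim: s => // x [|y s] IHs _.
  by exists x; rewrite ?mem_head // => m' /[!inE] /eqP->; apply: term_order_refl.
have [//|m ms mmin] := IHs; case/orP: (tot x m) => [lexm|lemx].
  exists x; first exact: mem_head.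
  by move=> m' /[1!in_cons] /predU1P[->|/mmin]; [apply: term_order_refl|apply: tr lexm].
exists m; first by rewrite in_cons ms orbT.
by move=> m' /[1!in_cons] /predU1P[->|/mmin].
Qed.

Lemma lead_exists (K : fieldType) (p : {mpoly K[N]}) :
  p != 0 -> exists m, is_lead le p m.
Proof. by rewrite -msupp_eq0 => /term_order_max[m ms mmax]; exists m. Qed.

End TermOrder.

(** Monomials are compared by their total degree in the variables outside [X],
    then by the degree order; so a polynomial whose lead involves only variables
    of [X] involves no other variable. *)
Section EliminationOrder.
Variables (N : nat) (X : {set 'I_N}).

Definition outer_degree (m : 'X_{1..N}) : nat := \sum_(i | i \notin X) m i.

Definition elimination_order : rel 'X_{1..N} := fun m1 m2 =>
  (outer_degree m1 < outer_degree m2)%N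
  || (outer_degree m1 == outer_degree m2) && (m1 <= m2)%O.

Lemma outer_degreeD m1 m2 :
  outer_degree (m1 + m2)%MM = (outer_degree m1 + outer_degree m2)%N.
Proof. by rewrite -big_split; apply: eq_bigr => i _; rewrite mnmDE. Qed.

Lemma elimination_term_order : term_order elimination_order.
Proof.
split.
- move=> m1 m2; rewrite /elimination_order; case: ltngtP => //= _.
  exact: Order.TotalTheory.le_total.
- move=> m1 m2; rewrite /elimination_order; case: ltngtP => //= _ le12.
  exact: Order.POrderTheory.le_anti.
- move=> m2 m1 m3; rewrite /elimination_order.
  case: (ltngtP (outer_degree m1)) => //= [lt12 _|eq12 le12].
    case: (ltngtP (outer_degree m2)) => //= [lt23 _|eq23 _].
      by rewrite (ltn_trans lt12 lt23).
    by rewrite -eq23 lt12.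
  rewrite eq12; case: ltngtP => //= _.
  exact: Order.POrderTheory.le_trans.
- move=> m; rewrite /elimination_order le0m andbT.
  rewrite /outer_degree big1; last by move=> i _; rewrite mnm0E.
  by rewrite -leq_eqVlt leq0n || rewrite orbC -leq_eqVlt.
move=> m m1 m2; rewrite /elimination_order !outer_degreeD ltn_add2l eqn_add2l.
by rewrite lemc_add2r.
Qed.

End EliminationOrder.

(** * Universal Groebner bases of graded binomial ideals *)

(** Abstract setting: [d] is a grading, no element of the ideal [I] has a single
    term in some degree ([I_partner]), and [L] is a finite list of binomials of
    [I], given by their pairs of exponents, such that any two distinct monomials
    of the same degree contain the two sides of one of them ([L_conformal]). *)

Section GradedBinomials.
Variables (K : fieldType) (N M : nat).
Local Notation S := {mpoly K[N]}.
Local Notation mon := 'X_{1..N}.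
Variables (I : S -> Prop) (d : mon -> 'X_{1..M}) (L : seq (mon * mon)).

Hypothesis IB : forall p q, I p -> I q -> I (p - q).
Hypothesis d_add : forall m1 m2, d (m1 + m2)%MM = (d m1 + d m2)%MM.
Hypothesis I_partner : forall p m, I p -> m \in msupp p ->
  exists m', [/\ m' \in msupp p, m' != m & d m' = d m].
Hypothesis L_in : forall a b, (a, b) \in L -> I ('X_[a] - 'X_[b]).
Hypothesis L_d : forall a b, (a, b) \in L -> d a = d b.
Hypothesis L_neq : forall a b, (a, b) \in L -> a != b.
Hypothesis L_conformal : forall u v, u != v -> d u = d v ->
  exists a b, [/\ (a, b) \in L, (a <= u)%MM & (b <= v)%MM].

Section Order.
Variables (le : rel mon) (le_to : term_order le).

(** When the pair found inside [u], [v] points the wrong way, dividing it out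
    leaves a smaller pair that still points the right way, as the order is
    compatible with products. *)
Lemma conformal_oriented u v : u != v -> d u = d v -> le v u ->
  exists a b, [/\ (a, b) \in L, (a <= u)%MM, (b <= v)%MM & le b a].
Proof.
have [k] := ubnP (mdeg u + mdeg v)%N.
elim: k => // k IHk in u v * => bound neq_uv duv le_vu.
have [a [b [abL au bv]]] := L_conformal neq_uv duv.
have neq_ab := L_neq abL.
have [le_ba|nle_ba] := boolP (le b a); first by exists a, b.
have le_ab : le a b by case: (le_to) => tot _ _ _ _; have := tot a b; rewrite (negPf nle_ba) orbF.
have uE := submK au; have vE := submK bv.
set u' := (u - a)%MM in uE; set v' := (v - b)%MM in vE.
have le_v'u' : le v' u'.
  apply: (term_order_cancel le_to (m := a)).
  case: (le_to) => _ _ tr _ leD.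
  have : le (v' + a)%MM (u' + a)%MM.
    rewrite uE; apply: tr le_vu; rewrite -vE.
    exact: leD.
  by rewrite ![(a + _)%MM]addmC.
have d' : d u' = d v'.
  have := duv; rewrite -uE -vE !d_add (L_d abL) => /eqP.
  by rewrite eqm_add2r => /eqP.
have neq' : u' != v'.
  apply: contraNneq nle_ba => eq'; move: le_vu; rewrite -uE -vE eq'.
  exact: term_order_cancel.
have bound' : (mdeg u' + mdeg v' < k)%N.
  rewrite -ltnS; apply: leq_ltn_trans bound; rewrite -uE -vE !mdegD.
  rewrite addnACA -addn1 leq_add2l lt0n addn_eq0 !mdeg_eq0 negb_and.
  by apply: contraNT neq_ab; rewrite negb_or !negbK => /andP[/eqP-> /eqP->].
have [a' [b' [abL' au' bv' le_ba']]] := IHk u' v' bound' neq' d' le_v'u'.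
exists a', b'; split=> //.
  by apply: lepm_trans au' _; apply: lem_subr.
by apply: lepm_trans bv' _; apply: lem_subr.
Qed.

(** By [lead_reducible] these are the monomials of the initial ideal of [I]. *)
Definition reducible u : Prop :=
  exists a b, [/\ (a, b) \in L, le b a & (a <= u)%MM].

Lemma lead_reducible p m : I p -> is_lead le p m -> reducible m.
Proof.
move=> Ip [mp mmax]; have [m' [m'p neq dm']] := I_partner Ip mp.
have [||| a [b [abL am _ leba]]] := @conformal_oriented m m'; rewrite 1?eq_sym //.
  exact: mmax.
by exists a, b.
Qed.

(** The lead is a minimal generator of the initial ideal, and the other monomial
    is standard. *)
Definition reduced_pair (ab : mon * mon) : bool :=
  [&& le ab.2 ab.1,
      all (fun ab' => le ab'.2 ab'.1 && (ab'.1 <= ab.1)%MM ==> (ab'.1 == ab.1)) L &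
      all (fun ab' => ~~ (le ab'.2 ab'.1 && (ab'.1 <= ab.2)%MM)) L].

Lemma reduced_pairP a b : reduced_pair (a, b) <->
  [/\ le b a,
      forall a' b', (a', b') \in L -> le b' a' -> (a' <= a)%MM -> a' = a &
      ~ reducible b].
Proof.
split=> [/and3P[/= leba /allP min /allP red]|[leba min red]].
  split=> //.
    by move=> a' b' /min /= /implyP + le' a'a; rewrite le' a'a => /(_ isT) /eqP.
  by move=> [a' [b' [/red /= + le' a'b]]]; rewrite le' a'b.
apply/and3P; split=> //=; apply/allP => -[a' b'] /= abL'.
  by apply/implyP => /andP[le' a'a]; apply/eqP/(min a' b').
by apply/negP => /andP[le' a'b]; apply: red; exists a', b'.
Qed.

(** Take [a] minimal for divisibility among the leads that divide [u], then the
    smallest [v] paired with [a].  If [v] were divisible by another lead [a'],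
    replacing [a'] by [b'] in it would give a smaller [v'] of the same degree as
    [a]; a pair conformal to [a], [v'] has lead [a] by minimality, and a second
    monomial below [v'], against the choice of [v]. *)
Lemma reduced_pair_exists u : reducible u ->
  exists a b, [/\ (a, b) \in L, reduced_pair (a, b) & (a <= u)%MM].
Proof.
have [k] := ubnP (mdeg u).
elim: k => // k IHk in u * => bound [a [b [abL leba au]]].
have [/hasP[[a' b'] abL' /= /and3P[le' a'a neq]]|/hasPn min] :=
  boolP (has (fun ab' => [&& le ab'.2 ab'.1, (ab'.1 <= a)%MM & ab'.1 != a]) L).
  have [||a0 [b0 [? ? a0a]]] := IHk a'; last 1 first.
  - exists a0, b0; split=> //; apply: lepm_trans au; exact: lepm_trans a'a.
  - apply: leq_trans (mdeg_ltm a'a neq) _; rewrite -ltnS.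
    by apply: leq_ltn_trans bound; rewrite -(submK au) mdegD leq_addl.
  by exists a', b'; split=> //; apply: lepm_refl.
have minP a' b' : (a', b') \in L -> le b' a' -> (a' <= a)%MM -> a' = a.
  by move=> /min /= + le' a'a; rewrite le' a'a /= negbK => /eqP.
have [|v vs vmin] := term_order_min le_to (s := [seq ab.2 | ab <- L & (ab.1 == a) && le ab.2
  ab.1]).
  have : b \in [seq ab.2 | ab <- L & (ab.1 == a) && le ab.2 ab.1].
    by apply/mapP; exists (a, b); rewrite ?mem_filter ?eqxx ?leba.
  by case: map.
have [[a1 b1]] := mapP vs; rewrite mem_filter /= => /andP[/andP[/eqP eq1 lev] vL] eq2.
subst a1 b1; exists a, v; split=> //; apply/reduced_pairP; split=> // -[a' [b' [abL' le' a'v]]].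
set v' := (b' + (v - a'))%MM.
have vE : (a' + (v - a'))%MM = v by rewrite addmC submK.
case: (le_to) => _ _ tr _ leD.
have lev'v : le v' v by rewrite -vE /v' ![(_ + (v - a'))%MM]addmC; apply: leD.
have neqv'v : v' != v.
  by rewrite -vE /v' eqm_add2r eq_sym; apply: L_neq abL'.
have dv' : d a = d v'.
  by rewrite (L_d vL) -vE /v' !d_add (L_d abL').
have neqa : a != v'.
  apply: contraNneq neqv'v => eqa; apply/eqP/(term_order_anti le_to) => //.
  by rewrite -eqa.
have [|a2 [b2 [L2 a2a b2v le2]]] := conformal_oriented neqa dv'; first exact: tr lev.
have eqa2 := minP _ _ L2 le2 a2a; subst a2.
have : le v b2 by apply: vmin; apply/mapP; exists (a, b2); rewrite ?mem_filter ?eqxx ?le2.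
move=> levb; case/negP: neqv'v; apply/eqP/(term_order_anti le_to) => //.
by apply: tr levb _; apply: (term_order_dvd le_to).
Qed.

Definition reduced_basis : seq S :=
  [seq 'X_[ab.1] - 'X_[ab.2] | ab <- L & reduced_pair ab].

Lemma msupp_binomial (a b m : mon) :
  a != b -> (m \in msupp ('X_[a] - 'X_[b] : S)) = (m == a) || (m == b).
Proof.
move=> neq; rewrite mcoeff_msupp mcoeffB !mcoeffX ![_ == m]eq_sym.
have [->|_] := eqVneq m a.
  by rewrite (negPf neq) subr0; apply: oner_neq0.
by rewrite sub0r oppr_eq0; case: (m == b); rewrite ?oner_eq0 ?eqxx.
Qed.

Lemma lead_binomial (a b : mon) :
  a != b -> le b a -> is_lead le ('X_[a] - 'X_[b] : S) a.
Proof.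
move=> neq leba; split=> [|m]; rewrite msupp_binomial ?eqxx //.
by case/orP=> /eqP-> //; apply: term_order_refl.
Qed.

Lemma is_lead_uniq (p : S) m m' : is_lead le p m -> is_lead le p m' -> m = m'.
Proof. by move=> [mp mmax] [m'p m'max]; apply: (term_order_anti le_to); auto. Qed.

Lemma reduced_basis_reduced : reduced_groebner_basis le I reduced_basis.
Proof.
have inI g : g \in reduced_basis -> I g.
  by move=> /mapP[[a b]]; rewrite mem_filter => /andP[_ /L_in Iab] ->.
have rb_elim g : g \in reduced_basis -> exists a b,
   [/\ (a, b) \in L, reduced_pair (a, b), g = 'X_[a] - 'X_[b] & is_lead le g a].
  move=> /mapP[[a b]]; rewrite mem_filter /= => /andP[rab abL] ->.
  exists a, b; split=> //; apply: lead_binomial; first exact: L_neq.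
  by case/and3P: rab.
split.
- split=> // p; split; apply: ideal_gen_trans => q [f [m [If lm ->]]]; last first.
    by apply: mem_ideal_gen; exists f, m; split; auto.
  have [a [b [abL rab am]]] := reduced_pair_exists (lead_reducible If lm).
  rewrite -(submK am) mpolyXD; apply/ideal_genM/mem_ideal_gen.
  exists ('X_[a] - 'X_[b]), a; split=> //.
    by apply/mapP; exists (a, b); rewrite // mem_filter rab.
  by apply: lead_binomial; [apply: L_neq|case/and3P: rab].
- move=> g /rb_elim[a [b [abL rab -> lg]]]; exists a => //.
  by rewrite mcoeffB !mcoeffX eqxx eq_sym (negPf (L_neq abL)) subr0.
move=> g h m m' /rb_elim[a [b [abL /reduced_pairP[leab mina redb] gE lg]]].
move=> /rb_elim[a' [b' [abL' /reduced_pairP[leab' mina' redb'] hE lh]]] neq mg lh'.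
rewrite (is_lead_uniq lh' lh) {lh'}.
move: mg; rewrite gE msupp_binomial ?(L_neq abL) // => /orP[]/eqP->; last first.
  by apply/negP=> a'b; apply: redb; exists a', b'.
apply: contraNN neq => a'a; have eqa := mina _ _ abL' leab' a'a; subst a'.
apply/eqP; rewrite gE hE; congr (_ - 'X_[_]).
(* If two reduced pairs have the same lead, the larger second monomial is reducible. *)
have [//|neqb] := eqVneq b b'.
have db : d b = d b' by rewrite -(L_d abL) (L_d abL').
case: (le_to) => tot _ _ _ _.
case/orP: (tot b b') => leb.
  have [|||a2 [b2 [L2 ? ? ?]]] := @conformal_oriented b' b; rewrite 1?eq_sym //.
  by case: redb'; exists a2, b2.
have [|||a2 [b2 [L2 ? ? ?]]] := @conformal_oriented b b' => //.
by case: redb; exists a2, b2.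
Qed.

(** A member [p] of a reduced basis has the same lead [a] as some reduced pair
    [(a, b)].  The difference [p - (X^a - X^b)] lies in [I], but none of its
    monomials is in the initial ideal: those of [p] by reducedness, and [b]
    because it is standard.  So it vanishes. *)
Lemma reduced_groebner_basisP (B : seq S) p :
  reduced_groebner_basis le I B -> p \in B ->
  exists a b, (a, b) \in L /\ p = 'X_[a] - 'X_[b].
Proof.
move=> [[BI gbB] monB redB] pB.
have dvdB q m : I q -> is_lead le q m ->
    exists h m', [/\ h \in B, is_lead le h m' & (m' <= m)%MM].
  move=> Iq lm; have : initial_ideal le I 'X_[m] by apply: mem_ideal_gen; exists q, m.
  move/gbB/msupp_initial_ideal; apply; exact/mem_msuppXP.
have [u lu pu] := monB _ pB; have Ip := BI _ pB.
have [a [b [abL rab au]]] := reduced_pair_exists (lead_reducible Ip lu).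
have [leab mina redb] := (reduced_pairP a b).1 rab.
have neqab := L_neq abL.
have dvdp q m h m' : I q -> is_lead le q m -> h \in B -> is_lead le h m' ->
   (m' <= m)%MM -> m \in msupp p -> h = p.
  move=> Iq lm hB lh m'm mp; apply/eqP; rewrite eq_sym; apply/negP => neq.
  by move/negP: neq => /(redB p h m m' pB hB) /(_ mp lh); rewrite m'm.
have eqa : a = u.
  have lab := lead_binomial neqab leab.
  have [h [m' [hB lh m'a]]] := dvdB _ _ (L_in abL) lab.
  have hp : h = p.
    apply/eqP; rewrite eq_sym; apply/negP => /negP neq.
    case: lu => up _; have := redB p h u m' pB hB neq up lh.
    by rewrite (lepm_trans m'a au).
  rewrite hp in lh; rewrite (is_lead_uniq lu lh) in au *.
  by apply/mnmP => i; apply/eqP; rewrite eqn_leq (mnm_lepP au) (mnm_lepP m'a).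
subst u; exists a, b; split=> //; apply/eqP; rewrite -subr_eq0; apply/negP=> /negP neq0.
set q := p - _ in neq0.
have Iq : I q by apply: IB => //; apply: L_in.
have [m lm] := lead_exists le_to neq0.
have mneqa : m != a.
  apply/eqP=> ma; case: lm; rewrite mcoeff_msupp ma !mcoeffB pu !mcoeffX eqxx.
  by rewrite (eq_sym b) (negPf neqab) subr0 subrr eqxx.
have [mp|mNp] := boolP (m \in msupp p).
  have [h [m' [hB lh m'm]]] := dvdB _ _ Iq lm.
  have hp := dvdp _ _ _ _ Iq lm hB lh m'm mp; subst h.
  rewrite (is_lead_uniq lh lu) in m'm.
  case/eqP: mneqa; apply: (term_order_anti le_to); first by case: lu => _; apply.
  exact: (term_order_dvd le_to).
have mb : m = b.
  case: (lm) => + _; rewrite mcoeff_msupp mcoeffB (memN_msupp_eq0 mNp) sub0r oppr_eq0.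
  by rewrite -mcoeff_msupp msupp_binomial // (negPf mneqa) => /eqP.
by apply: redb; rewrite -mb; apply: lead_reducible lm.
Qed.

End Order.

Hypothesis L_sym : forall a b, (a, b) \in L -> (b, a) \in L.
Hypothesis L_circuit : forall a b a' b', (a, b) \in L -> (a', b') \in L ->
  (forall i, (a + b)%MM i = 0%N -> (a' + b')%MM i = 0%N) ->
  (a', b') = (a, b) \/ (a', b') = (b, a).

(** For the order that eliminates the variables outside [a + b], a pair whose
    lead divides [a] or [b] lies entirely in the variables of [a + b], so it is
    [(a, b)] up to swapping. *)
Lemma circuit_universal a b : (a, b) \in L ->
  up_to_sign (universal_groebner_basis I) ('X_[a] - 'X_[b]).
Proof.
move=> abL0; pose X := [set i | (a + b)%MM i != 0%N].
pose le := elimination_order X; have le_to : term_order le := elimination_term_order X.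
have supported m i : outer_degree X m = 0%N -> i \notin X -> m i = 0%N.
  by move=> /eqP; rewrite sum_nat_eq0 => /forall_inP m0 /m0 /eqP.
have support_circuit a' b' : (a', b') \in L -> le b' a' -> outer_degree X a' = 0%N ->
    (a', b') = (a, b) \/ (a', b') = (b, a).
  move=> abL' le' out0; apply: L_circuit => // i abi.
  have out0' : outer_degree X b' = 0%N by move: le';
    rewrite /le /elimination_order out0 => /orP[//|/andP[/eqP]].
  by rewrite mnmDE !supported // inE abi.
have out_ab : outer_degree X (a + b)%MM = 0%N.
  by apply/eqP; rewrite sum_nat_eq0; apply/forall_inP => i; rewrite inE negbK.
clearbody X.
wlog leba : a b abL0 support_circuit out_ab / le b a.
  move=> IH; case: (le_to) => tot _ _ _ _; case/orP: (tot b a) => leab; first exact: IH.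
  have [H|H] : up_to_sign (universal_groebner_basis I) ('X_[b] - 'X_[a]).
  - apply: IH => //; [exact: L_sym| |by rewrite addmC].
    by move=> a' b' H1 H2 H3; case: (support_circuit a' b'); auto.
  - by right; rewrite opprB.
  by left; rewrite -opprB.
have [outa outb] : outer_degree X a = 0%N /\ outer_degree X b = 0%N.
  by move/eqP: out_ab; rewrite outer_degreeD addn_eq0 => /andP[/eqP ? /eqP ?].
have neq := L_neq abL0.
have out_dvd m m' : (m <= m')%MM -> outer_degree X m' = 0%N -> outer_degree X m = 0%N.
  by move=> /submK <-; rewrite outer_degreeD => /eqP; rewrite addn_eq0 => /andP[_ /eqP].
have nleab : ~~ le a b by apply: contraNN neq => leab; apply/eqP/(term_order_anti le_to).
have rab : reduced_pair le (a, b).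
  apply/reduced_pairP; split=> //.
    move=> a' b' abL' le' a'a; have := out_dvd _ _ a'a outa => out'.
    by case: (support_circuit _ _ abL' le' out') => -[? ?]; subst a' b' => //;
      rewrite le' in nleab.
  move=> [a' [b' [abL' le' a'b]]]; have := out_dvd _ _ a'b outb => out'.
  case: (support_circuit _ _ abL' le' out') => -[? ?]; subst a' b'; last by rewrite le' in nleab.
  by rewrite (term_order_dvd le_to) in nleab.
left; exists le, (reduced_basis le); split=> //; first exact: reduced_basis_reduced.
by apply/mapP; exists (a, b); rewrite // mem_filter rab.
Qed.

Theorem universal_groebner_basis_circuits p :
  up_to_sign (universal_groebner_basis I) p <->
  exists a b, (a, b) \in L /\ p = 'X_[a] - 'X_[b].
Proof.
split=> [|[a [b [abL ->]]]]; last exact: circuit_universal.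
case=> -[le [B [le_to rB pB]]].
  exact: (reduced_groebner_basisP le_to rB pB).
have [a [b [abL pE]]] := reduced_groebner_basisP le_to rB pB.
exists b, a; split; first exact: L_sym.
by rewrite -[p]opprK pE opprB.
Qed.

End GradedBinomials.

(** * Cycle monomials of a graph with labelled edges *)

Lemma eq_set2 (T : finType) (a b c d : T) :
  [set a; b] = [set c; d] -> (a = c /\ b = d) \/ (a = d /\ b = c).
Proof.
move=> eq_s; have: c \in [set a; b] by rewrite eq_s set21.
have: d \in [set a; b] by rewrite eq_s set22.
have: b \in [set c; d] by rewrite -eq_s set22.
have: a \in [set c; d] by rewrite -eq_s set21.
rewrite !in_set2 => /orP[]/eqP<- /orP[]/eqP<- /orP[]/eqP e1 /orP[]/eqP e2; auto.
Qed.

Lemma nth_rot1 (T : Type) (x0 : T) (u : seq T) j : (j < size u)%N ->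
  nth x0 (rot 1 u) j = nth x0 u (j.+1 %% size u).
Proof.
case: u => // x p; rewrite rot1_cons /= nth_rcons ltnS leq_eqVlt.
by case/predU1P => [->|lt_j]; rewrite ?ltnn ?eqxx ?modnn // lt_j modn_small.
Qed.

Section CycleVertices.
Variables (T : finType) (x0 : T) (u : seq T).

(** Indices are taken modulo the length, so that no case distinction is made at
    the closing edge of a cycle. *)
Definition cnth (j : nat) : T := nth x0 u (j %% size u).

Hypotheses (u_uniq : uniq u) (u_gt2 : (2 < size u)%N).

Lemma cnth_mod j : cnth (j %% size u) = cnth j.
Proof. by rewrite /cnth modn_mod. Qed.

Lemma mem_cnth j : cnth j \in u.
Proof. by rewrite mem_nth // ltn_mod; case: u u_gt2. Qed.

Lemma cnthP x : x \in u -> exists2 j, (j < size u)%N & x = cnth j.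
Proof. by move=> /(nthP x0)[j lt_j <-]; exists j; rewrite // /cnth modn_small. Qed.

Lemma cnth_eq i j : (cnth i == cnth j) = (i == j %[mod size u]).
Proof. by rewrite nth_uniq // ltn_mod; case: u u_gt2. Qed.

Lemma size_cycle_edges : size (cycle_edges u) = size u.
Proof. by rewrite size_map size_zip size_rot minnn. Qed.

Lemma nth_cycle_edges j : (j < size u)%N ->
  nth set0 (cycle_edges u) j = [set cnth j; cnth j.+1].
Proof.
move=> lt_j; rewrite (nth_map (x0, x0)) ?size_zip ?size_rot ?minnn //.
by rewrite nth_zip ?size_rot //= nth_rot1 // /cnth (modn_small lt_j).
Qed.

Lemma cycle_edgesP g :
  reflect (exists j, g = [set cnth j; cnth j.+1]) (g \in cycle_edges u).
Proof.
have k0 : (0 < size u)%N by case: u u_gt2.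
apply: (iffP idP) => [/(nthP set0)[j]|[j ->]].
  by rewrite size_cycle_edges => lt_j <-; exists j; rewrite nth_cycle_edges.
have lt_j : (j %% size u < size u)%N by rewrite ltn_mod.
apply/(nthP set0); exists (j %% size u)%N; first by rewrite size_cycle_edges.
rewrite nth_cycle_edges // cnth_mod; congr [set _; _].
by rewrite /cnth -addn1 modnDml addn1.
Qed.

(** The length is at least 3, so an edge does not occur again reversed. *)
Lemma cycle_edge_inj i j :
  [set cnth i; cnth i.+1] = [set cnth j; cnth j.+1] -> i = j %[mod size u].
Proof.
case/eq_set2 => -[/eqP + /eqP]; rewrite !cnth_eq; first by move/eqP.
move=> /eqP ij /eqP; rewrite -[i.+1]addn1 -modnDml ij modnDml -[j in RHS]addn0 -addn1 -addnA =>
  /eqP.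
by rewrite eqn_modDl mod0n modn_small.
Qed.

Lemma cycle_edges_uniq : uniq (cycle_edges u).
Proof.
apply/(uniqP set0) => i j; rewrite !inE size_cycle_edges => lt_i lt_j.
by rewrite !nth_cycle_edges // => /cycle_edge_inj; rewrite !modn_small.
Qed.

Lemma mem_cycle_edge i j : (cnth i.+1 \in [set cnth j; cnth j.+1]) ->
  j = i %[mod size u] \/ j = i.+1 %[mod size u].
Proof.
rewrite in_set2 !cnth_eq => /orP[/eqP->|]; first by right.
by rewrite -addn1 -[j.+1]addn1 eqn_modDr => /eqP->; left.
Qed.

End CycleVertices.

Section EdgeMonomials.
Variables (T : finType) (N : nat) (edge : 'I_N -> {set T}).
Local Notation mon := 'X_{1..N}.

Definition edge_rel : rel T := fun x y => [exists i, edge i == [set x; y]].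

Definition degree_at (m : mon) (x : T) : nat := \sum_i m i * (x \in edge i).

Definition vertex_degrees (m : mon) : 'X_{1..#|T|} :=
  [multinom degree_at m (enum_val j) | j < #|T|].

Lemma vertex_degreesP m m' :
  (forall x, degree_at m x = degree_at m' x) <-> vertex_degrees m = vertex_degrees m'.
Proof.
split=> [eq_d|/mnmP eq_d x]; first by apply/mnmP => j; rewrite !mnmE eq_d.
by have := eq_d (enum_rank x); rewrite !mnmE enum_rankK.
Qed.

Lemma degree_atD m m' x :
  degree_at (m + m')%MM x = (degree_at m x + degree_at m' x)%N.
Proof. by rewrite -big_split; apply: eq_bigr => i _; rewrite /= mnmDE mulnDl. Qed.

Lemma vertex_degreesD m m' :
  vertex_degrees (m + m')%MM = (vertex_degrees m + vertex_degrees m')%MM.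
Proof. by apply/mnmP => j; rewrite mnmDE !mnmE degree_atD. Qed.

Lemma degree_atU i x : degree_at U_(i)%MM x = (x \in edge i).
Proof.
rewrite /degree_at (bigD1 i) //= mnm1E eqxx mul1n big1 ?addn0 // => j neq.
by rewrite mnm1E eq_sym (negPf neq).
Qed.

(** The two sides of the binomial of a cycle with sequence of edges [g]. *)
Definition alt_mon (b : bool) (g : seq {set T}) : mon :=
  [multinom ((edge i \in g) && (odd (index (edge i) g) == b) : nat) | i < N].

Hypothesis edge_inj : injective edge.
Hypothesis edge_pair : forall i, exists x y, x != y /\ edge i = [set x; y].

Section Cycle.
Variables (x0 : T) (u : seq T).
Hypotheses (u_cycle : is_cycle edge_rel u) (u_even : ~~ odd (size u)).

Let u_uniq : uniq u. Proof. by case/and3P: u_cycle. Qed.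
Let u_gt2 : (2 < size u)%N. Proof. by case/and3P: u_cycle. Qed.
Let size_gt0 : (0 < size u)%N. Proof. by case: u u_gt2. Qed.
Local Notation v := (cnth x0 u).
Local Notation g := (cycle_edges u).

Lemma cycle_edge_index j : exists i, edge i == [set v j; v j.+1].
Proof.
have [_ _] := and3P u_cycle; move: size_gt0 => k0.
have lt_j : (j %% size u < size u)%N by rewrite ltn_mod.
have -> : [set v j; v j.+1] = nth set0 g (j %% size u).
  rewrite (nth_cycle_edges x0) // cnth_mod; congr [set _; _].
  by rewrite /cnth -[in RHS]addn1 modnDml addn1.
rewrite /cycle_edges (nth_map (x0, x0)) ?size_zip ?size_rot ?minnn // nth_zip ?size_rot //=.
case: (u) lt_j => // x p; rewrite rot1_cons /= => lt_j /(pathP x0)/(_ (j %% (size p).+1)%N).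
rewrite size_rcons => /(_ lt_j) /existsP[i /eqP ei]; exists i; rewrite ei; apply/eqP;
  congr [set _; _].
by rewrite -rcons_cons nth_rcons lt_j.
Qed.

Definition cycle_index j : 'I_N := xchoose (cycle_edge_index j).

Lemma edge_cycle_index j : edge (cycle_index j) = [set v j; v j.+1].
Proof. exact/eqP/(xchooseP (cycle_edge_index j)). Qed.

Lemma cycle_index_eq i j :
  (cycle_index i == cycle_index j) = (i == j %[mod size u]).
Proof.
apply/eqP/eqP => [/(congr1 edge)|eq_ij].
  by rewrite !edge_cycle_index; apply: cycle_edge_inj.
apply: edge_inj; rewrite !edge_cycle_index; congr [set _; _]; apply/eqP; rewrite cnth_eq //.
  exact/eqP.
by rewrite -addn1 -modnDml eq_ij modnDml addn1.
Qed.

Lemma cycle_indexP i : edge i \in g -> exists2 j, (j < size u)%N & i = cycle_index j.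
Proof.
move=> /(cycle_edgesP x0 u_gt2)[j eq_i]; exists (j %% size u)%N; first by rewrite ltn_mod.
apply/edge_inj/esym; rewrite eq_i -edge_cycle_index; congr edge; apply/eqP.
by rewrite cycle_index_eq modn_mod.
Qed.

Lemma cycle_index_in j : edge (cycle_index j) \in g.
Proof. by apply/(cycle_edgesP x0 u_gt2); exists j; rewrite edge_cycle_index. Qed.

Lemma alt_mon_cycle b j : alt_mon b g (cycle_index j) = (odd j == b).
Proof.
rewrite mnmE cycle_index_in /=; congr (nat_of_bool (_ == _)).
have lt_j : (j %% size u < size u)%N by rewrite ltn_mod.
have -> : edge (cycle_index j) = nth set0 g (j %% size u).
  rewrite (nth_cycle_edges x0) // -edge_cycle_index; congr edge; apply/eqP.
  by rewrite cycle_index_eq modn_mod.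
rewrite index_uniq ?size_cycle_edges ?(cycle_edges_uniq x0) //.
by rewrite {2}(divn_eq j (size u)) oddD oddM (negPf u_even) andbF.
Qed.

Definition supported (m : mon) := forall i, edge i \notin g -> m i = 0%N.

Lemma alt_mon_supported b : supported (alt_mon b g).
Proof. by move=> i /negPf gi; rewrite mnmE gi. Qed.

Lemma supported_eq m m' : supported m -> supported m' ->
  (forall j, m (cycle_index j) = m' (cycle_index j)) -> m = m'.
Proof.
move=> sm sm' eq_m; apply/mnmP => i; have [/cycle_indexP[j _ ->]//|gi] := boolP (edge i \in g).
by rewrite sm ?sm'.
Qed.

(** Exactly two edges of a cycle meet at each of its vertices. *)
Lemma degree_at_cycle m j : supported m ->
  degree_at m (v j.+1) = (m (cycle_index j) + m (cycle_index j.+1))%N.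
Proof.
move=> sm; have neq : cycle_index j.+1 != cycle_index j.
  rewrite cycle_index_eq -addn1 -[j in X in _ != X]addn0 eqn_modDl mod0n modn_small //.
  exact: ltnW.
rewrite /degree_at (bigD1 (cycle_index j)) //= (bigD1 (cycle_index j.+1)) //=.
rewrite !edge_cycle_index set22 set21 !muln1 big1 ?addn0 // => i /andP[neq1 neq2].
have [/cycle_indexP[k _ eq_i]|/sm->//] := boolP (edge i \in g).
rewrite eq_i edge_cycle_index; case: (boolP (_ \in _)) => [/mem_cycle_edge|_];
  last by rewrite muln0.
move: neq1 neq2; rewrite eq_i !cycle_index_eq => /eqP neq1 /eqP neq2.
by case.
Qed.

Lemma degree_at_off_cycle m x : supported m -> x \notin u -> degree_at m x = 0%N.
Proof.
move=> sm xu; rewrite /degree_at big1 // => i _.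
have [/cycle_indexP[k _ ->]|/sm->//] := boolP (edge i \in g).
rewrite edge_cycle_index in_set2; case: eqP => [eqx|_].
  by rewrite eqx mem_cnth in xu.
by case: eqP => [eqx|_]; rewrite ?muln0 //; rewrite eqx mem_cnth in xu.
Qed.

Lemma cycle_vertex_succ x : x \in u -> exists j, x = v j.+1.
Proof.
move=> /(cnthP x0)[j _ ->]; exists (j + (size u).-1)%N.
by rewrite -addnS prednK // /cnth modnDr.
Qed.

Lemma degree_alt_mon : vertex_degrees (alt_mon false g) = vertex_degrees (alt_mon true g).
Proof.
apply/vertex_degreesP => x.
have [/cycle_vertex_succ[j ->]|xu] := boolP (x \in u).
  rewrite !degree_at_cycle; try exact: alt_mon_supported.
  by rewrite !alt_mon_cycle /=; case: (odd j).
by rewrite !degree_at_off_cycle //; apply: alt_mon_supported.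
Qed.

Lemma alt_mon_neq : alt_mon false g != alt_mon true g.
Proof.
apply/eqP => /mnmP/(_ (cycle_index 0)).
by rewrite !alt_mon_cycle.
Qed.

(** Along the cycle, the equality of degrees at each vertex propagates the
    exponents from one edge to the next, in alternation. *)
Lemma alternating_solution m m' : supported m -> supported m' ->
  vertex_degrees m = vertex_degrees m' ->
  m (cycle_index 0) = 1%N -> m' (cycle_index 0) = 0%N ->
  (forall i, m i <= 1)%N -> (forall i, m' i <= 1)%N ->
  (forall i, m i = 0%N \/ m' i = 0%N) ->
  m = alt_mon false g /\ m' = alt_mon true g.
Proof.
move=> sm sm' /vertex_degreesP dmm' m0 m'0 le1 le1' dis.
have vals j : m (cycle_index j) = (odd j == false) /\ m' (cycle_index j) = (odd j == true).
  elim: j => [|j [IH IH']]; first by rewrite m0 m'0.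
  have := dmm' (v j.+1); rewrite !degree_at_cycle // IH IH' /=.
  have := dis (cycle_index j.+1); have := le1 (cycle_index j.+1); have := le1' (cycle_index j.+1).
  by case: (odd j) => /=; lia.
by split; apply: supported_eq => //; try exact: alt_mon_supported;
  move=> j; case: (vals j); rewrite alt_mon_cycle.
Qed.

Lemma prod_cycle_edges (K : fieldType) (F : {set T} -> {mpoly K[N]}) (b : bool) :
  (forall i, F (edge i) = 'X_i) ->
  \prod_(j < size g | odd j == b) F (nth set0 g j) = 'X_[alt_mon b g].
Proof.
move=> FX; rewrite size_cycle_edges.
rewrite (eq_bigr (fun j : 'I_(size u) => 'X_[U_(cycle_index j)])); last first.
  by move=> j _; rewrite (nth_cycle_edges x0) // -edge_cycle_index FX.
rewrite mprodXE; congr 'X_[_].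
apply: supported_eq; [|exact: alt_mon_supported|].
  move=> i gi; rewrite mnm_sumE big1 // => j _; rewrite mnm1E.
  by case: eqP gi => // <-; rewrite cycle_index_in.
move=> j; rewrite alt_mon_cycle mnm_sumE.
have lt_j : (j %% size u < size u)%N by rewrite ltn_mod.
rewrite (eq_bigr (fun i : 'I_(size u) => nat_of_bool (i == Ordinal lt_j))); last first.
  by move=> i _; rewrite mnm1E cycle_index_eq (modn_small (ltn_ord i)).
have oddj : odd (j %% size u) = odd j.
  by rewrite {2}(divn_eq j (size u)) oddD oddM (negPf u_even) andbF.
case: eqP => ob; last first.
  rewrite big1 // => i /eqP oi; case: eqP => // ij; case: ob.
  by rewrite -oddj -oi ij.
rewrite (bigD1 (Ordinal lt_j)) /= ?oddj ?ob // eqxx big1 // => i /andP[_ /negPf->//].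
Qed.

End Cycle.

Lemma alt_mon_rot u b : is_cycle edge_rel u -> ~~ odd (size u) ->
  is_cycle edge_rel (rot 1 u) /\
  alt_mon b (cycle_edges (rot 1 u)) = alt_mon (~~ b) (cycle_edges u).
Proof.
move=> cu eu; have cu' : is_cycle edge_rel (rot 1 u).
  by rewrite /is_cycle size_rot rot_uniq rot_cycle.
split=> //; have [x0 _] : exists x0, x0 \in u by case: (u) cu => // x s; exists x;
  rewrite mem_head.
have cE j : cnth x0 (rot 1 u) j = cnth x0 u j.+1.
  case/and3P: cu => u2 uu _.
  have lt_j : (j %% size u < size u)%N by rewrite ltn_mod; case: (u) u2.
  by rewrite /cnth size_rot nth_rot1 // -[in LHS]addn1 modnDml addn1.
have iE j : cycle_index x0 cu' j = cycle_index x0 cu j.+1.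
  by apply: edge_inj; rewrite !edge_cycle_index !cE.
have eu' : ~~ odd (size (rot 1 u)) by rewrite size_rot.
have memE : cycle_edges (rot 1 u) =i cycle_edges u.
  have [u2 uu _] := and3P cu; have [u2' uu' _] := and3P cu'.
  move=> h; apply/(cycle_edgesP x0 u2')/(cycle_edgesP x0 u2) => -[j ->].
    by exists j.+1; rewrite !cE.
  exists (j + (size u).-1)%N; rewrite !cE.
  have -> : (j + (size u).-1).+1 = (j + size u)%N by case: (u) u2 => // x p _; rewrite /= addnS.
  by rewrite -addSn /cnth !modnDr.
apply: (supported_eq (x0 := x0) (u_cycle := cu')).
- exact: alt_mon_supported.
- by move=> i; rewrite memE => /negPf gi; rewrite mnmE gi.
by move=> j; rewrite alt_mon_cycle // iE alt_mon_cycle //=; case: (odd j); case: b.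
Qed.

Lemma alt_mon_le1 b g i : (alt_mon b g i <= 1)%N.
Proof. by rewrite mnmE leq_b1. Qed.

Lemma alt_mon_disjoint g i : alt_mon false g i = 0%N \/ alt_mon true g i = 0%N.
Proof. by rewrite !mnmE; case: (odd _); rewrite ?andbF; auto. Qed.

(** The exponents of [u'] form a solution, supported on the edges of [u], of the
    equations at the vertices of [u]; these have a one-dimensional solution
    space, spanned by the alternating vector. *)
Lemma alt_mon_circuit u u' :
  is_cycle edge_rel u -> ~~ odd (size u) -> is_cycle edge_rel u' -> ~~ odd (size u') ->
  let a := alt_mon false (cycle_edges u) in let b := alt_mon true (cycle_edges u) in
  let a' := alt_mon false (cycle_edges u') in let b' := alt_mon true (cycle_edges u') in
  (forall i, (a + b)%MM i = 0%N -> (a' + b')%MM i = 0%N) ->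
  (a', b') = (a, b) \/ (a', b') = (b, a).
Proof.
move=> cu eu cu' eu' a b a' b' sub.
have [x0 _] : exists x0, x0 \in u by case: (u) cu => // x s; exists x; rewrite mem_head.
have sab i : edge i \notin cycle_edges u -> a' i = 0%N /\ b' i = 0%N.
  move=> gi; have := sub i;
    rewrite !mnmDE (alt_mon_supported false gi) (alt_mon_supported true gi) => /(_ (erefl _)).
  by move=> /eqP; rewrite addn_eq0 => /andP[/eqP ? /eqP ?].
have sa : supported u a' by move=> i /sab[].
have sb : supported u b' by move=> i /sab[].
have dab : vertex_degrees a' = vertex_degrees b' by apply: (degree_alt_mon (u := u') x0).
have le1 := alt_mon_le1; have dis := alt_mon_disjoint (cycle_edges u').
pose i0 := cycle_index x0 cu 0.
have := le1 false (cycle_edges u') i0; have := le1 true (cycle_edges u') i0.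
rewrite -/a' -/b' => le_b le_a.
have [a0|a0] : a' i0 = 0%N \/ a' i0 = 1%N by lia.
  have [b0|b0] : b' i0 = 0%N \/ b' i0 = 1%N by lia.
    have vals j : a' (cycle_index x0 cu j) = 0%N /\ b' (cycle_index x0 cu j) = 0%N.
      elim: j => [//|j [IH IH']].
      have := (vertex_degreesP _ _).2 dab (cnth x0 u j.+1).
      rewrite !(degree_at_cycle x0 cu) // IH IH'.
      rewrite !add0n => eqab; have := dis (cycle_index x0 cu j.+1); rewrite -/a' -/b' eqab.
      by case.
    case/eqP: (alt_mon_neq x0 cu' eu'); rewrite -/a' -/b'.
    by apply: (supported_eq (x0 := x0) (u_cycle := cu)) => // j; have [vj ->] := vals j;
      rewrite -vj.
  have dis' i : b' i = 0%N \/ a' i = 0%N by case: (dis i); auto.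
  by have [-> ->] := alternating_solution eu sb sa (esym dab) b0 a0 (le1 _ _) (le1 _ _) dis';
    right.
have b0 : b' i0 = 0%N by case: (dis i0) => //; rewrite -/a' a0.
by have [-> ->] := alternating_solution eu sa sb dab a0 b0 (le1 _ _) (le1 _ _) dis; left.
Qed.

Hypothesis odd_walks_meet : forall w1 w2 : seq T,
  cycle edge_rel w1 -> cycle edge_rel w2 -> odd (size w1) -> odd (size w2) ->
  exists x y, [/\ x != y, x \in w1, y \in w1, x \in w2 & y \in w2].

(** An edge is red if its exponent in [m] is the larger one, blue if its exponent
    in [m'] is; a vertex with a red edge and no blue one would have a larger
    degree in [m] than in [m']. *)
Lemma conformal_cycle (m m' : mon) : m != m' -> vertex_degrees m = vertex_degrees m' ->
  exists u, [/\ is_cycle edge_rel u, ~~ odd (size u),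
    (alt_mon false (cycle_edges u) <= m)%MM & (alt_mon true (cycle_edges u) <= m')%MM].
Proof.
move=> neq /vertex_degreesP dmm'.
pose gap b i := if b then (m i < m' i)%N else (m' i < m i)%N.
pose R b : rel T := fun x y => [exists i, (edge i == [set x; y]) && gap b i].
have R_sym b : ssrbool.symmetric (R b) by move=> x y; rewrite /R setUC.
have R_adj b : subrel (R b) edge_rel.
  by move=> x y /existsP[i /andP[ei _]]; apply/existsP; exists i.
have gapN b i : gap b i -> ~~ gap (~~ b) i.
  by rewrite /gap; case: b => /=; rewrite -leqNgt => /ltnW.
have R_disjoint b x y : R b x y -> ~~ R (~~ b) x y.
  move=> /existsP[i /andP[/eqP ei gi]]; apply/existsP => -[j /andP[/eqP ej gj]].
  have ij : i = j by apply: edge_inj; rewrite ei ej.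
  by move: (gapN _ _ gi); rewrite ij gj.
have gap_progress b i x : x \in edge i -> gap b i -> exists2 j, x \in edge j & gap (~~ b) j.
  move=> xi gi; have [/existsP[j /andP[? ?]]|] := boolP [exists j, (x \in edge j) && gap (~~ b)
    j].
    by exists j.
  rewrite negb_exists => /forallP no; have := dmm' x.
  rewrite /degree_at (bigD1 i) //= [RHS](bigD1 i) //= xi !muln1.
  have cmp j : if b then (m j * (x \in edge j) <= m' j * (x \in edge j))%N
                    else (m' j * (x \in edge j) <= m j * (x \in edge j))%N.
    move: (no j); rewrite /gap; case: (x \in _); rewrite ?muln0 ?muln1 /=; last by case: (b).
    by case: (b); rewrite /= -leqNgt.
  move: gi cmp; rewrite /gap; case: (b) => lt_i le_j.
    have le_s := leq_sum (index_enum 'I_N) (fun j (_ : j != i) => le_j j).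
    by move=> eq_s; have := leq_add lt_i le_s; rewrite addSn eq_s ltnn.
  have le_s := leq_sum (index_enum 'I_N) (fun j (_ : j != i) => le_j j).
  by move=> eq_s; have := leq_add lt_i le_s; rewrite addSn -eq_s ltnn.
have R_progress b x y : R b x y -> exists z, R (~~ b) y z.
  move=> /existsP[i /andP[/eqP ei gi]].
  have [|j yj gj] := gap_progress b i y _ gi; first by rewrite ei set22.
  have [z [t [zt ej]]] := edge_pair j.
  move: yj; rewrite ej in_set2 => /orP[]/eqP ->.
    by exists t; apply/existsP; exists j; rewrite ej eqxx.
  by exists z; apply/existsP; exists j; rewrite ej setUC eqxx.
have [b [x [y Rxy]]] : exists b x y, R b x y.
  have [i neqi] : exists i, m i != m' i.
    apply/existsP; apply: contraNT neq; rewrite negb_exists => /forallP eq_m.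
    by apply/eqP/mnmP => i; apply/eqP; rewrite -[_ == _]negbK.
  have [x [y [_ ei]]] := edge_pair i.
  exists (m i < m' i)%N, x, y; apply/existsP; exists i; rewrite ei eqxx /gap.
  by move: neqi; case: ltngtP.
have [z [p [up p2 ep steps]]] :=
  alternating_cycle_exists R_sym R_adj R_disjoint R_progress odd_walks_meet Rxy.
have cu : is_cycle edge_rel (z :: p).
  rewrite /is_cycle p2 up /=; apply/(pathP z) => j; rewrite size_rcons => lt_j.
  by rewrite -rcons_cons nth_rcons lt_j; apply: (R_adj (odd j)); apply: steps.
exists (z :: p); split=> //; apply/mnm_lepP => i.
  have [gi|gi] := boolP (edge i \in cycle_edges (z :: p)); last by rewrite alt_mon_supported.
  have [j lt_j ->] := cycle_indexP z cu gi; rewrite alt_mon_cycle //.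
  have [//|oj] := boolP (odd j); have := steps j lt_j;
    rewrite (negPf oj) => /existsP[k /andP[/eqP ek]].
  suff -> : k = cycle_index z cu j by apply: leq_ltn_trans.
  by apply: edge_inj; rewrite edge_cycle_index ek /cnth -nth_rot1 // modn_small // rot1_cons.
have [gi|gi] := boolP (edge i \in cycle_edges (z :: p)); last by rewrite alt_mon_supported.
have [j lt_j ->] := cycle_indexP z cu gi; rewrite alt_mon_cycle //.
have [oj|//] := boolP (odd j); have := steps j lt_j; rewrite oj => /existsP[k /andP[/eqP ek]].
suff -> : k = cycle_index z cu j by apply: leq_ltn_trans.
by apply: edge_inj; rewrite edge_cycle_index ek /cnth -nth_rot1 // modn_small // rot1_cons.
Qed.

End EdgeMonomials.

(** * The labelled edges of H *)

Section GraphHStructure.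
Variables (n : nat) (e : rel 'I_n) (c : seq 'I_n).
Hypotheses (e_sym : ssrbool.symmetric e) (e_irr : irreflexive e).
Hypotheses (e_conn : connected_graph e) (c_unique : unique_cycle e c).
Variable (x0 : 'I_n).

Local Notation k := (size c).
Local Notation v := (cnth x0 c).
Local Notation off := (off_cycle e c).

Let c_cycle : is_cycle e c. Proof. by case: c_unique. Qed.
Let c_uniq : uniq c. Proof. by case/and3P: c_cycle. Qed.
Let c_gt2 : (2 < k)%N. Proof. by case/and3P: c_cycle. Qed.
Let c_gt0 : (0 < k)%N. Proof. by case: c c_gt2. Qed.

Lemma cycle_step j : e (v j) (v j.+1).
Proof.
have [_ _] := and3P c_cycle; move: c_gt0 => k0.
have lt_j : (j %% k < k)%N by rewrite ltn_mod.
have -> : v j.+1 = nth x0 (rot 1 c) (j %% k) by rewrite nth_rot1 // /cnth -[in LHS]addn1 -modnDml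
  addn1.
rewrite /cnth; case: (c) lt_j => // x p lt_j /(pathP x0)/(_ (j %% size (x :: p))%N).
by rewrite size_rcons => /(_ lt_j); rewrite rot1_cons -rcons_cons nth_rcons lt_j.
Qed.

Lemma connect_along_cycle (r : rel 'I_n) :
  (forall j, r (v j) (v j.+1)) -> forall x y, x \in c -> y \in c -> connect r x y.
Proof.
move=> rc; suff con j i : connect r (v j) (v (j + i)).
  move=> _ _ /(cnthP x0)[i lt_i ->] /(cnthP x0)[j lt_j ->].
  have -> : v j = v (i + (j + k - i)) by rewrite subnKC ?(leq_trans (ltnW lt_i)) ?leq_addl //
    /cnth modnDr.
  exact: con.
by elim: i => [|i IHi]; rewrite ?addn0 // addnS; apply: connect_trans IHi (connect1 (rc _)).
Qed.

Definition remove_edge (x y : 'I_n) : rel 'I_n :=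
  [rel a b | e a b && ([set a; b] != [set x; y])].

Lemma remove_edge_sym x y : ssrbool.symmetric (remove_edge x y).
Proof. by move=> a b; rewrite /remove_edge /= e_sym setUC. Qed.

Lemma connect_remove_edgeC x y a b :
  connect (remove_edge x y) a b = connect (remove_edge x y) b a.
Proof. exact/sym_connect_sym/remove_edge_sym. Qed.

Lemma off_cycle_sym : ssrbool.symmetric off.
Proof. by move=> a b; rewrite /off_cycle /= e_sym setUC. Qed.

(** A path avoiding the edge [{x, y}] between its ends would close up to a second
    cycle, one containing this edge. *)
Lemma off_cycle_bridge x y : off x y -> ~~ connect (remove_edge x y) x y.
Proof.
move=> /andP[exy /negP xyN]; apply/negP => /connectP[p0 path0].
case/shortenP: path0 => p pathp up _ yE; apply: xyN.
case: c_unique => _ /(_ (x :: p)) <-.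
  have p2 : (2 < size (x :: p))%N.
    case: p yE pathp {up} => [yx|z [zy|//]] /=; first by rewrite yx e_irr in exy.
    by rewrite zy /remove_edge /= eqxx andbF.
  apply/(cycle_edgesP x p2); exists (size p); rewrite /cnth /= modnn modn_small //.
  by rewrite -last_nth -yE setUC.
have pe : path e x p by apply: sub_path pathp => a b /andP[].
rewrite /is_cycle up /= rcons_path pe -yE e_sym exy !andbT.
case: p yE pathp {up pe} => [yx|z [zy|//]] /=; first by rewrite yx e_irr in exy.
by rewrite zy /remove_edge /= eqxx andbF.
Qed.

Lemma remove_edge_cycle x y : off x y -> forall j, remove_edge x y (v j) (v j.+1).
Proof.
move=> /andP[_ xyN] j; rewrite /remove_edge /= cycle_step /=.
by apply: contraNneq xyN => <-; apply/(cycle_edgesP x0 c_gt2); exists j.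
Qed.

(** Otherwise the first edge of a simple path from [a] to [b] off the cycle would
    not be a bridge: one can go round through [b] and back along the cycle. *)
Lemma off_cycle_separated a b : a \in c -> b \in c -> connect off a b -> a = b.
Proof.
move=> ac bc /connectP[p0 path0]; case/shortenP: path0 => p pathp up _ bE.
case: p pathp up bE => [//|y p] /= /andP[ay pathp] /andP[aN _] bE.
case/negP: (off_cycle_bridge ay).
have con_ba := connect_along_cycle (remove_edge_cycle ay) ac bc.
apply: connect_trans con_ba _; rewrite connect_remove_edgeC; apply/connectP.
exists p => //; apply: (@sub_in_path _ [pred z | z != a]) pathp.
  move=> z t /= za ta /andP[ezt _]; rewrite /remove_edge /= ezt /=.
  apply: contraNneq za => eq_s; have : a \in [set z; t] by rewrite eq_s set21.
  by rewrite in_set2 ![a == _]eq_sym (negPf ta) orbF.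
by apply/allP => z zp /=; apply: contraNneq aN => <-.
Qed.

Lemma cycle_vertex_of r : exists2 i, i \in c & connect off i r.
Proof.
have [i0 ic] : exists i, i \in c by exists (v 0); apply: mem_cnth.
have /connectP[p path_p ->] := e_conn i0 r.
elim/last_ind: p path_p => [_|p s IHp]; first by exists i0.
rewrite rcons_path last_rcons => /andP[/IHp[i ic' con] es].
have [cyc|ncyc] := boolP ([set last i0 p; s] \in cycle_edges c).
  have [j eq_s] := cycle_edgesP x0 c_gt2 _ cyc.
  exists s => //; have : s \in [set v j; v j.+1] by rewrite -eq_s set22.
  by rewrite in_set2 => /orP[]/eqP->; apply: mem_cnth.
by exists i => //; apply: connect_trans con (connect1 _); rewrite /off_cycle /= es.
Qed.

(** The edge [{c_1, c_k}], over which the two sides of the prism are exchanged. *)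
Definition twisted (r s : 'I_n) : bool :=
  if c is x :: p then [set r; s] == [set x; last x p] else false.

Lemma twistedC r s : twisted r s = twisted s r.
Proof. by rewrite /twisted setUC. Qed.

Lemma last_first_edge x p : c = x :: p -> [set x; last x p] = [set v k.-1; v k].
Proof.
by move=> cE; rewrite /cnth cE /= modnn modn_small // setUC (last_nth x0).
Qed.

Lemma twisted_cnth j : (j < k)%N -> twisted (v j) (v j.+1) = (j == k.-1).
Proof.
move=> lt_j; have [x [p cE]] : exists x p, c = x :: p by case: (c) c_gt2 => // x p; exists x, p.
have -> : twisted (v j) (v j.+1) = ([set v j; v j.+1] == [set v k.-1; v k.-1.+1]).
  by rewrite prednK // -(last_first_edge cE) {1}/twisted {1}cE.
apply/eqP/eqP => [/(cycle_edge_inj c_uniq c_gt2)|-> //].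
by rewrite !modn_small // prednK.
Qed.

Lemma twisted_cycle r s : twisted r s -> [set r; s] \in cycle_edges c.
Proof.
have [x [p cE]] : exists x p, c = x :: p by case: (c) c_gt2 => // x p; exists x, p.
rewrite {1}/twisted {1}cE (last_first_edge cE) => /eqP->.
by apply/(cycle_edgesP x0 c_gt2); exists k.-1; rewrite prednK.
Qed.

Lemma off_not_twisted r s : off r s -> twisted r s = false.
Proof. by move=> /andP[_]; apply: contraNF; apply: twisted_cycle. Qed.

Lemma cycle_edge_adj r s : [set r; s] \in cycle_edges c -> e r s.
Proof.
move=> /(cycle_edgesP x0 c_gt2)[j /eq_set2[][-> ->]]; last rewrite e_sym; exact: cycle_step.
Qed.

Lemma twisted_irr r : twisted r r = false.
Proof. by apply/negP => /twisted_cycle/cycle_edge_adj; rewrite e_irr. Qed.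

(** The edge labelled [(a, b)] joins a vertex over [a] to one over [b];
    [lift_side a b] says which of [vtx a], [wtx a] is the former: it is [wtx]
    when [(a, b)] is listed against the orientation that the prism uses. *)
Definition lift_side (a b : 'I_n) : bool :=
  ~~ twisted a b &&
  (if [set a; b] \in cycle_edges c then (index b c < index a c)%N else (b < a)%N).

Definition lift_edge (a b : 'I_n) : {set 'I_n * bool} :=
  [set (a, lift_side a b); (b, lift_side a b (+) (twisted a b || (a == b)))].

Definition label_ok (a b : 'I_n) := (a == b) || e a b.

(** The edges labelled [(a, b)] and [(b, a)] are the two disjoint lifts of the
    edge [{a, b}]. *)
Lemma lift_sideC a b : a != b ->
  lift_side b a (+) twisted b a = ~~ lift_side a b.
Proof.
move=> neq; rewrite /lift_side twistedC (setUC [set b]).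
case: (twisted a b) => //=; rewrite addbF.
  case: ifP => [|_]; last by move: neq;
    rewrite -(inj_eq (@ord_inj n)) -leqNgt [in RHS]leq_eqVlt => /negPf->.
move=> /(cycle_edgesP x0 c_gt2)[j eq_s].
have [ac bc] : a \in c /\ b \in c.
  by case/eq_set2: eq_s => -[-> ->]; rewrite !mem_cnth.
rewrite -leqNgt [in RHS]leq_eqVlt; case: eqP => // eq_i.
by rewrite -(nth_index x0 ac) eq_i nth_index ?eqxx in neq.
Qed.

Lemma lift_edge_inj a b a' b' :
  lift_edge a b = lift_edge a' b' -> (a, b) = (a', b').
Proof.
case/eq_set2 => -[[-> eq1] [bE eq2]]; rewrite bE // in eq1 *.
have [->//|neq] := eqVneq a' b'.
have := lift_sideC neq; rewrite eq1 (negPf neq) orbF twistedC.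
by case: (twisted b' a'); case: (lift_side a' b').
Qed.

Lemma lift_side_step j : (j.+1 < k)%N ->
  lift_side (v j) (v j.+1) = false /\ lift_side (v j.+1) (v j) = true.
Proof.
move=> lt_j; have lt_j' := ltnW lt_j.
have edge_j : [set v j; v j.+1] \in cycle_edges c by apply/(cycle_edgesP x0 c_gt2); exists j.
have tw_j : twisted (v j) (v j.+1) = false by rewrite twisted_cnth //; apply/eqP; lia.
rewrite /lift_side [twisted (v j.+1) _]twistedC tw_j (setUC [set v j.+1]) edge_j /=.
by rewrite /cnth !modn_small // !index_uniq //; split; lia.
Qed.

Lemma lift_edge_refl r : lift_edge r r = [set vtx r; wtx r].
Proof. by rewrite /lift_edge /lift_side twisted_irr eqxx !ltnn if_same. Qed.

Lemma lift_edge_step j : (j.+1 < k)%N ->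
  lift_edge (v j) (v j.+1) = [set vtx (v j); vtx (v j.+1)] /\
  lift_edge (v j.+1) (v j) = [set wtx (v j); wtx (v j.+1)].
Proof.
move=> lt_j; have lt_j' := ltnW lt_j; have [sj sj'] := lift_side_step lt_j.
have tw_j : twisted (v j) (v j.+1) = false by rewrite twisted_cnth //; apply/eqP; lia.
have neq : v j == v j.+1 = false.
  by apply: contraTF (cycle_step j) => /eqP {1}->; rewrite e_irr.
rewrite /lift_edge sj sj' [twisted (v j.+1) _]twistedC tw_j [v j.+1 == _]eq_sym neq.
by rewrite (setUC [set vtx _]) setUC; split=> //; rewrite setUC.
Qed.

Lemma lift_edge_twisted r s : twisted r s -> lift_edge r s = [set vtx r; wtx s].
Proof. by move=> tw; rewrite /lift_edge /lift_side tw. Qed.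

Lemma lift_edge_off r s : off r s -> (r < s)%N ->
  lift_edge r s = [set vtx r; vtx s] /\ lift_edge s r = [set wtx r; wtx s].
Proof.
move=> off_rs lt_rs; have tw := off_not_twisted off_rs.
have /andP[_ /negPf nc] := off_rs.
have neq : (r == s) = false by apply: contraTF lt_rs => /eqP->; rewrite ltnn.
rewrite /lift_edge /lift_side [twisted s r]twistedC tw (setUC [set s]) nc [s == r]eq_sym neq /=.
by rewrite lt_rs ltnNge (ltnW lt_rs) /= setUC; split=> //; rewrite setUC.
Qed.

Lemma mem_zip_behead p : reflect (exists2 j, (j.+1 < k)%N & p = (v j, v j.+1))
  (p \in zip c (behead c)).
Proof.
have zipE j : (j.+1 < k)%N -> nth (x0, x0) (zip c (behead c)) j = (v j, v j.+1).
  move=> lt_j; have lt_j' := ltnW lt_j; rewrite nth_zip_cond size_zip size_behead.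
  rewrite (_ : j < _)%N; last by lia.
  by rewrite nth_behead /cnth !modn_small.
apply: (iffP idP) => [/(nthP (x0, x0))[j]|[j lt_j ->]].
  rewrite size_zip size_behead (minn_idPr (leq_pred _)) => lt_j <-;
    rewrite -ltnS prednK // in lt_j.
  by exists j; rewrite ?zipE.
by apply/(nthP (x0, x0)); exists j;
  rewrite ?zipE // size_zip size_behead (minn_idPr (leq_pred _)) -ltnS prednK.
Qed.

Lemma mem_rungs (V : {set 'I_n}) (z : labelled_edge n) :
  reflect (exists2 r, r \in V & z = ((r, r), [set vtx r; wtx r])) (z \in rungs V).
Proof. exact: imsetP. Qed.

(** The whole construction of H amounts to this: one edge for each variable of
    S. *)
Lemma mem_graphH (a b : 'I_n) (g : {set 'I_n * bool}) :
  ((a, b, g) \in graphH e c) = label_ok a b && (g == lift_edge a b).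
Proof.
have stepE j : label_ok (v j) (v j.+1) /\ label_ok (v j.+1) (v j).
  by rewrite /label_ok [e (v j.+1) _]e_sym cycle_step !orbT.
apply/idP/andP => [|[+ /eqP->]].
  case/setUP => [|/bigcupP[i _]].
    case/setUP => [/setUP[/setUP[]|]|].
    - by case/mem_rungs => r _ [-> -> ->]; rewrite /label_ok eqxx lift_edge_refl.
    - case/imsetP => p /mem_zip_behead[j lt_j ->] [-> -> ->] /=.
      by case: (lift_edge_step lt_j) (stepE j) => -> _ [].
    - case/imsetP => p /mem_zip_behead[j lt_j ->] [-> -> ->] /=.
      by case: (lift_edge_step lt_j) (stepE j) => _ -> [].
    have [x [p cE]] : exists x p, c = x :: p by case: (c) c_gt2 => // x p; exists x, p.
    have tw : twisted x (last x p) by rewrite /twisted cE.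
    have ok : e x (last x p) by apply/cycle_edge_adj/twisted_cycle.
    rewrite {1}cE => /set2P[][-> -> ->]; rewrite /label_ok ?ok ?orbT 1?[e _ x]e_sym ?ok ?orbT.
      by rewrite lift_edge_twisted.
    by rewrite lift_edge_twisted // twistedC.
  case/setUP => [/setUP[]|].
  - by case/mem_rungs => r _ [-> -> ->]; rewrite /label_ok eqxx lift_edge_refl.
  - case/imsetP => -[r s]; rewrite inE /= => /andP[_ /andP[off_rs lt_rs]] [-> -> ->].
    by rewrite /label_ok (lift_edge_off off_rs lt_rs).1; case/andP: (off_rs) => -> _;
      rewrite orbT.
  case/imsetP => -[r s]; rewrite inE /= => /andP[_ /andP[off_rs lt_rs]] [-> -> ->].
  by rewrite /label_ok (lift_edge_off off_rs lt_rs).2 e_sym; case/andP: (off_rs) => -> _;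
    rewrite orbT.
have in_tree i r : i \in c -> connect off i r -> forall z, z \in prism (tree_vertices e c i) off
  -> z \in graphH e c.
  move=> ic _ z zp; apply/setUP; right; apply/bigcupP; exists i => //; by rewrite inE.
have [i ic con] := cycle_vertex_of a.
case/predU1P => [<-|e_ab].
  apply: (in_tree i a) => //; apply/setUP; left; apply/setUP; left.
  by apply/mem_rungs; exists a; rewrite ?inE ?lift_edge_refl.
have [cyc|ncyc] := boolP ([set a; b] \in cycle_edges c); last first.
  have off_ab : off a b by rewrite /off_cycle /= e_ab.
  have off_ba : off b a by rewrite off_cycle_sym.
  have conb : connect off i b by apply: connect_trans con (connect1 off_ab).
  apply: (in_tree i a) => //; case: (ltngtP a b) => [lt|lt|/ord_inj eq_ab].
  - apply/setUP; left; apply/setUP; right; apply/imsetP; exists (a, b).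
      by rewrite !inE /= con conb off_ab lt.
    by rewrite (lift_edge_off off_ab lt).1.
  - apply/setUP; right; apply/imsetP; exists (b, a).
      by rewrite !inE /= con conb off_ba lt.
    by rewrite (lift_edge_off off_ba lt).2.
  by rewrite eq_ab e_irr in e_ab.
apply/setUP; left.
have [j0 eq_s0] := cycle_edgesP x0 c_gt2 _ cyc.
have [j lt_j eq_s] : exists2 j, (j < k)%N & [set a; b] = [set v j; v j.+1].
  exists (j0 %% k)%N; first by rewrite ltn_mod.
  by rewrite cnth_mod eq_s0; congr [set _; _]; rewrite /cnth -[in RHS]addn1 modnDml addn1.
have [lt_j1|ge_j1] := ltnP j.+1 k.
  have [E1 E2] := lift_edge_step lt_j1.
  have zj : (v j, v j.+1) \in zip c (behead c) by apply/mem_zip_behead; exists j.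
  apply/setUP; left; case/eq_set2: eq_s => -[-> ->].
    by apply/setUP; left; apply/setUP; right; apply/imsetP; exists (v j, v j.+1); rewrite ?E1.
  by apply/setUP; right; apply/imsetP; exists (v j, v j.+1); rewrite ?E2.
have jE : j = k.-1 by lia.
have [x [p cE]] : exists x p, c = x :: p by case: (c) c_gt2 => // x p; exists x, p.
apply/setUP; right.
have tw : twisted a b by rewrite /twisted cE eq_s (last_first_edge cE) jE prednK.
rewrite cE lift_edge_twisted //; move: tw; rewrite /twisted cE => /eqP/eq_set2[][-> ->].
  by rewrite set21.
by rewrite set22.
Qed.

(** H is a double cover of G in which the two points over each vertex are
    joined. *)
Lemma adjHP x y : adjH e c x y ->
  (x.1 = y.1 /\ y.2 = ~~ x.2) \/ (e x.1 y.1 /\ y.2 = x.2 (+) twisted x.1 y.1).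
Proof.
case: x y => [r a] [s b] /existsP[[[r' s'] g]] /andP[]; rewrite mem_graphH /=.
move=> /andP[ok /eqP->] /eqP/esym/eq_set2.
case/predU1P: ok => [<-|ok].
  rewrite eqxx orbT addbT.
  by case=> -[[-> ->] [-> ->]]; left; rewrite ?negbK.
have neq : (r' == s') = false by apply: contraTF ok => /eqP->; rewrite e_irr.
rewrite neq orbF; case=> -[[-> ->] [-> ->]]; right=> //.
by rewrite e_sym ok [twisted s' _]twistedC addbK.
Qed.

(** * Odd closed walks in H *)

Variables (f : 'I_n -> bool).
Hypothesis f_proper : forall r s, e r s -> f r != f s.

(** The part of G attached to the vertices of index at most [j] of the cycle. *)
Definition arc (j : nat) (r : 'I_n) : bool :=
  [exists i : 'I_k, (i <= j)%N && connect off (v i) r].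

Lemma arc_cycle j i : (i < k)%N -> arc j (v i) = (i <= j)%N.
Proof.
move=> lt_i; apply/existsP/idP => [[i' /andP[le_j]]|le_j]; last first.
  by exists (Ordinal lt_i); rewrite le_j connect0.
move=> /off_cycle_separated -/(_ (mem_cnth _ c_gt2 _) (mem_cnth _ c_gt2 _)) /eqP.
by rewrite cnth_eq // !modn_small // => /eqP <-.
Qed.

Lemma arc_off j r s : off r s -> arc j r = arc j s.
Proof.
move=> off_rs; apply: eq_existsb => i; congr (_ && _).
apply/idP/idP => con; apply: connect_trans con (connect1 _) => //.
by rewrite off_cycle_sym.
Qed.

(** Along the cycle, [arc j] changes at the edge of index [j] and at the closing
    edge, which is the twisted one; for the last [j] these changes cancel. *)
Lemma arc_edge j r s : (j < k)%N -> e r s ->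
  twisted r s (+) arc j r (+) arc j s = ([set r; s] == [set v j; v j.+1]).
Proof.
move=> lt_j ers; have [cyc|ncyc] := boolP ([set r; s] \in cycle_edges c); last first.
  have off_rs : off r s by rewrite /off_cycle /= ers.
  rewrite (arc_off j off_rs) addbK off_not_twisted //; apply/esym.
  apply: contraNF ncyc => /eqP->; apply/(cycle_edgesP x0 c_gt2); by exists j.
have [i lt_i eq_s] : exists2 i, (i < k)%N & [set r; s] = [set v i; v i.+1].
  have [i eq_s] := cycle_edgesP x0 c_gt2 _ cyc.
  exists (i %% k)%N; first by rewrite ltn_mod.
  by rewrite cnth_mod eq_s; congr [set _; _]; rewrite /cnth -[in RHS]addn1 modnDml addn1.
have -> : ([set r; s] == [set v j; v j.+1]) = (i == j).
  rewrite eq_s; apply/eqP/eqP => [/(cycle_edge_inj c_uniq c_gt2)|->//].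
  by rewrite !modn_small.
wlog: r s ers cyc eq_s / r = v i /\ s = v i.+1.
  move=> IH; case/eq_set2: (eq_s) => -[E1 E2]; first exact: IH.
  by rewrite twistedC addbAC; apply: IH; rewrite 1?e_sym 1?setUC.
move=> [-> ->]; rewrite twisted_cnth // arc_cycle //.
have [lt_i1|ge_i1] := ltnP i.+1 k.
  by rewrite arc_cycle //; have -> : (i == k.-1) = false; [apply/eqP; lia | rewrite /=;
    case: ltngtP].
have iE : i = k.-1 by apply/eqP; rewrite eqn_leq -ltnS prednK // lt_i -ltnS prednK.
have -> : v i.+1 = v 0 by rewrite iE prednK // /cnth modnn mod0n.
rewrite arc_cycle // leq0n iE eqxx /= addbT negbK.
by rewrite eqn_leq -[(j <= _)%N]ltnS prednK // lt_j andbT.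
Qed.

(** The bipartition of G gives a colouring of the vertices of H which is proper
    except on the twisted edges; adding [arc j] moves the defect to the lifts of
    the cycle edge of index [j]. *)
Definition coloring j (x : 'I_n * bool) : bool := f x.1 (+) arc j x.1 (+) x.2.

Lemma coloring_constant j x y : (j < k)%N -> adjH e c x y ->
  coloring j x = coloring j y ->
  [set x.1; y.1] = [set v j; v j.+1] /\ y.2 = x.2 (+) twisted x.1 y.1.
Proof.
move=> lt_j /adjHP; rewrite /coloring; case=> [[-> ->]|[exy yE] eq_col].
  by case: (f _ (+) _); case: (x.2).
split=> //; apply/eqP; rewrite -(arc_edge lt_j exy).
have := f_proper exy; move: eq_col; rewrite yE.
by case: (f _); case: (f _); case: (arc _ _); case: (arc _ _); case: (x.2); case: (twisted _ _).
Qed.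

Lemma odd_walk_not_colored (T : eqType) (r : rel T) (col : T -> bool) w :
  cycle r w -> odd (size w) ->
  exists x y, [/\ x \in w, y \in w, r x y & col x = col y].
Proof.
move=> rw ow; have col_path x p : path [rel a b | r a b && (col a != col b)] x p ->
    col (last x p) = col x (+) odd (size p).
  elim: p x => [|y p IHp] x /=; first by rewrite addbF.
  by move=> /andP[/andP[_ neq] /IHp->]; rewrite addbN -addNb; move: neq; case: (col x);
    case: (col y).
case: w rw ow => // x p rw ow.
have [/hasP[y yw /hasP[z zw /andP[ryz /eqP]]]|none] :=
  boolP (has (fun y => has (fun z => r y z && (col y == col z)) (x :: p)) (x :: p)).
  by exists y, z.
have /col_path : path [rel a b | r a b && (col a != col b)] x (rcons p x).
  apply: (@sub_in_path _ (mem (x :: p))) rw; last first.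
    by apply/allP => y; rewrite -rcons_cons mem_rcons in_cons => /predU1P[->|//]; exact: mem_head.
  move=> y z yw zw ryz; rewrite /= ryz /=; move/hasPn/(_ y yw)/hasPn/(_ z zw): none.
  by rewrite ryz.
by rewrite last_rcons size_rcons; move: ow => /= ->; case: (col x).
Qed.

(** An odd closed walk contains an edge on which [coloring j] is constant. *)
Lemma odd_walk_visits w j : cycle (adjH e c) w -> odd (size w) -> (j < k)%N ->
  exists a, (v j, a) \in w /\ (v j.+1, a (+) (j == k.-1)) \in w.
Proof.
move=> cw ow lt_j; have [[r a] [[s b] [xw yw adj_xy eq_col]]] := odd_walk_not_colored (coloring
  j) cw ow.
have [/= eq_s bE] := coloring_constant lt_j adj_xy eq_col.
rewrite {}bE in yw; rewrite -(twisted_cnth lt_j).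
case/eq_set2: eq_s xw yw => -[-> ->] xw yw; first by exists a.
by exists (a (+) twisted (v j.+1) (v j)); rewrite [twisted (v j) _]twistedC addbK.
Qed.

(** Suppose that the walks share at most one vertex.  Over each cycle edge they
    use different lifts.  Consecutive lifts used by [w1] meet: otherwise [w1] and
    [w2] would both pass through the two points over the common vertex.  Hence
    [w1] stays on the side [a] and [w2] on the other side, up to the twisted
    edge, after which they have exchanged sides, so they share both points over
    the initial vertex. *)
Lemma odd_walks_share w1 w2 :
  cycle (adjH e c) w1 -> cycle (adjH e c) w2 -> odd (size w1) -> odd (size w2) ->
  exists x y, [/\ x != y, x \in w1, y \in w1, x \in w2 & y \in w2].
Proof.
move=> c1 c2 o1 o2; pose common x := (x \in w1) && (x \in w2).
have [/existsP[x /existsP[y /and3P[xy /andP[? ?] /andP[? ?]]]]|none] :=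
  boolP [exists x, exists y, [&& x != y, common x & common y]].
  by exists x, y.
have neq2 x y : x != y -> x \in w1 -> x \in w2 -> y \in w1 -> y \in w2 -> False.
  move=> xy x1 x2 y1 y2; case/negP: none; apply/existsP; exists x; apply/existsP; exists y.
  by rewrite xy /common x1 x2 y1 y2.
have sides_neq (r : 'I_n) a : (r, a) != (r, ~~ a) by rewrite xpair_eqE; case: a; rewrite andbF.
have opposite j a b : (j < k)%N -> (v j, a) \in w1 -> (v j.+1, a (+) (j == k.-1)) \in w1 ->
    (v j, b) \in w2 -> (v j.+1, b (+) (j == k.-1)) \in w2 -> b = ~~ a.
  move=> lt_j a1 a1' b2 b2'; have [eq_ab|] := eqVneq a b; last by case: a {a1 a1'};
    case: b {b2 b2'}.
  rewrite -eq_ab in b2 b2'; case: (neq2 _ _ _ a1 b2 a1' b2').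
  rewrite xpair_eqE negb_and; apply/orP; left.
  by apply: contraTneq (cycle_step j) => {1}->; rewrite e_irr.
have [a [a1 a1']] := odd_walk_visits c1 o1 c_gt0.
have [b [b2 b2']] := odd_walk_visits c2 o2 c_gt0.
have bE := opposite 0%N a b c_gt0 a1 a1' b2 b2'; rewrite {}bE in b2 b2'.
have all_j j : (j < k)%N -> [/\ (v j, a) \in w1, (v j.+1, a (+) (j == k.-1)) \in w1,
    (v j, ~~ a) \in w2 & (v j.+1, ~~ a (+) (j == k.-1)) \in w2].
  elim: j => [//|j IHj] lt_j; have [_ p1 _ p2] := IHj (ltnW lt_j).
  have jk : (j == k.-1) = false by apply/eqP => jE; rewrite jE prednK // ltnn in lt_j.
  rewrite jk !addbF in p1 p2.
  have [a' [q1 q1']] := odd_walk_visits c1 o1 lt_j.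
  have [b' [q2 q2']] := odd_walk_visits c2 o2 lt_j.
  have b'E := opposite _ _ _ lt_j q1 q1' q2 q2'; rewrite {}b'E in q2 q2'.
  have [aE|neq] := eqVneq a' a; first by rewrite -aE.
  have a'E : a' = ~~ a by move: neq; case: (a'); case: (a).
  rewrite a'E negbK in q1 q2.
  by case: (neq2 _ _ (sides_neq (v j.+1) a) p1 q2 q1 p2).
have [|_ p1 _ p2] := all_j k.-1; first by rewrite prednK.
have vk : v k.-1.+1 = v 0 by rewrite prednK // /cnth modnn mod0n.
rewrite eqxx !addbT negbK vk in p1 p2.
by case: (neq2 _ _ (sides_neq (v 0) a) a1 p2 p1 b2).
Qed.

(** * Exponent differences as functions of the degree *)

(** The functional [psi] kills every edge of G, for the signed incidence where
    the twisted edge has sign -1, except [{r, s}].  For an edge of the cycle it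
    is given by the signs of [coloring]; for another edge, which is a bridge, by
    the signs of the bipartition on the component that does not contain the
    cycle. *)
Lemma edge_functional r s : e r s -> exists psi : 'I_n -> int, forall x y, e x y ->
  (psi x + (-1) ^+ twisted x y * psi y == 0) = ([set x; y] != [set r; s]).
Proof.
move=> ers; have [cyc|ncyc] := boolP ([set r; s] \in cycle_edges c).
  have [i eq_s0] := cycle_edgesP x0 c_gt2 _ cyc.
  have [j lt_j ->] : exists2 j, (j < k)%N & [set r; s] = [set v j; v j.+1].
    exists (i %% k)%N; first by rewrite ltn_mod.
    by rewrite cnth_mod eq_s0; congr [set _; _]; rewrite /cnth -[in RHS]addn1 modnDml addn1.
  exists (fun x => (-1) ^+ (f x (+) arc j x)) => x y exy.
  rewrite -(arc_edge lt_j exy); have := f_proper exy.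
  by case: (f x); case: (f y); case: (arc j x); case: (arc j y); case: (twisted x y).
have off_rs : off r s by rewrite /off_cycle /= ers.
wlog c0N : r s ers ncyc off_rs / ~~ connect (remove_edge r s) s (v 0).
  move=> IH; have [c0s|] := boolP (connect (remove_edge r s) s (v 0)); last exact: IH.
  have eq_rel : connect (remove_edge s r) =2 connect (remove_edge r s).
    by apply: eq_connect => x y; rewrite /remove_edge /= [[set s; r]]setUC.
  rewrite [[set r; s]]setUC; apply: IH; rewrite 1?e_sym 1?[[set s;
    r]]setUC 1?off_cycle_sym // eq_rel.
  apply: contraNN (off_cycle_bridge off_rs) => c0r; apply: connect_trans c0r _.
  by rewrite connect_remove_edgeC.
pose D x := connect (remove_edge r s) s x.
have DN : D r = false.
  by apply: contraNF (off_cycle_bridge off_rs); rewrite /D connect_remove_edgeC.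
have Ds : D s by apply: connect0.
exists (fun x => if D x then (-1) ^+ f x else 0) => x y exy.
have := f_proper exy.
have [/eq_set2[][-> ->]|neq] := eqVneq [set x; y] [set r; s].
- by rewrite DN Ds off_not_twisted //; case: (f s).
- by rewrite DN Ds off_not_twisted 1?off_cycle_sym //; case: (f s).
have em : remove_edge r s x y by rewrite /remove_edge /= exy.
have Dxy : D x = D y.
  apply/idP/idP => Dx; apply: connect_trans Dx (connect1 _) => //.
  by rewrite remove_edge_sym.
case: (boolP (twisted x y)) => [tw|_]; last first.
  by rewrite Dxy; case: (D y); case: (f x); case: (f y).
have Dx : D x = false.
  apply: contraNF c0N => Dx; apply: connect_trans Dx _.
  apply: (connect_along_cycle (remove_edge_cycle off_rs)); last exact: mem_cnth.
  have [j /eq_set2[][-> _]] := cycle_edgesP x0 c_gt2 _ (twisted_cycle tw); exact: mem_cnth.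
by rewrite -Dxy Dx.
Qed.

End GraphHStructure.

(** * The toric ideal of a graph *)

Section ToricMap.
Variables (K : fieldType) (T : finType) (N : nat) (edge : 'I_N -> {set T}).

(** The map whose kernel is the toric ideal: the variable of an edge goes to the
    product of the variables of its ends. *)
Definition toric_map : {mpoly K[N]} -> {mpoly K[#|T|]} :=
  mmap (@mpolyC _ K) (fun i => 'X_[vertex_degrees edge U_(i)]).

Lemma mmap1_vertex_degrees m :
  mmap1 (fun i => 'X_[vertex_degrees edge U_(i)] : {mpoly K[#|T|]}) m =
  'X_[vertex_degrees edge m].
Proof.
rewrite /mmap1 mprodXnE; congr 'X_[_]; apply/mnmP => x.
rewrite mnm_sumE mnmE; apply: eq_bigr => i _.
by rewrite mulmnE mnmE degree_atU mulnC.
Qed.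

Lemma toric_mapX m : toric_map 'X_[m] = 'X_[vertex_degrees edge m].
Proof. by rewrite /toric_map mmapX mmap1_vertex_degrees. Qed.

Lemma toric_mapB p q : toric_map (p - q) = toric_map p - toric_map q.
Proof. exact: raddfB. Qed.

Lemma toric_mapM p q : toric_map (p * q) = toric_map p * toric_map q.
Proof. exact: (mmap_is_multiplicative _ _).1. Qed.

Lemma toric_map_ideal (A : {mpoly K[N]} -> Prop) p :
  (forall q, A q -> toric_map q = 0) -> ideal_gen A p -> toric_map p = 0.
Proof.
move=> A0 [s As ->]; rewrite /toric_map raddf_sum big_seq big1 // => x xs.
by rewrite /= -/(toric_map _) toric_mapM (A0 _ (As x xs)) mulr0.
Qed.

(** The terms of [p] with a given vertex degree have the same image, so their
    coefficients add up to 0 and there is not just one of them. *)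
Lemma toric_partner p m : toric_map p = 0 -> m \in msupp p ->
  exists m', [/\ m' \in msupp p, m' != m &
                 vertex_degrees edge m' = vertex_degrees edge m].
Proof.
move=> p0 mp; have [/hasP[m' m'p /andP[neq /eqP eq_d]]|/hasPn none] :=
  boolP (has (fun m' => (m' != m) && (vertex_degrees edge m' == vertex_degrees edge m)) (msupp
    p)).
  by exists m'.
have := congr1 (mcoeff (vertex_degrees edge m)) p0.
rewrite mcoeff0 /toric_map /mmap raddf_sum /= (bigD1_seq m) ?msupp_uniq //=.
rewrite mmap1_vertex_degrees mcoeffCM mcoeffX eqxx mulr1 big_seq_cond big1.
  by rewrite addr0 => pm0; move: mp; rewrite mcoeff_msupp pm0 eqxx.
move=> m' /andP[/none + neq]; rewrite neq /= => /negPf neq_d.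
by rewrite mmap1_vertex_degrees mcoeffCM mcoeffX neq_d mulr0.
Qed.

End ToricMap.

(** * The ideal P_G is the toric ideal of H *)

Section PrincipalMinors.
Variables (K : fieldType) (n : nat) (e : rel 'I_n) (c : seq 'I_n).
Hypotheses (e_sym : ssrbool.symmetric e) (e_irr : irreflexive e).
Hypotheses (e_conn : connected_graph e) (e_bip : bipartite e).
Hypothesis c_unique : unique_cycle e c.
Variable x0 : 'I_n.

Local Notation N := #|varidx e|.
Local Notation mon := 'X_{1..N}.
Local Notation S := (polyS K e).

Definition label (i : 'I_N) : 'I_n * 'I_n := val (enum_val i).

Definition label_edge (i : 'I_N) : {set 'I_n * bool} :=
  lift_edge c (label i).1 (label i).2.

Definition var_of a b (ok : label_ok e a b) : 'I_N :=
  enum_rank (exist _ (a, b) ok : varidx e).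

Lemma label_var_of a b (ok : label_ok e a b) : label (var_of ok) = (a, b).
Proof. by rewrite /label /var_of enum_rankK. Qed.

Lemma label_inj : injective label.
Proof. by move=> i j /val_inj/enum_val_inj. Qed.

Lemma label_okP i : label_ok e (label i).1 (label i).2.
Proof. by rewrite /label; case: (enum_val i) => -[a b]. Qed.

Lemma xvarE a b (ok : label_ok e a b) : xvar K e a b = 'X_(var_of ok).
Proof. by rewrite /xvar insubT. Qed.

Lemma label_edge_inj : injective label_edge.
Proof.
move=> i j /(lift_edge_inj c_unique x0) eq_l; apply: label_inj.
by rewrite [label i]surjective_pairing eq_l -surjective_pairing.
Qed.

Lemma label_edge_pair i : exists x y, x != y /\ label_edge i = [set x; y].
Proof.
rewrite /label_edge /lift_edge; have := label_okP i.
set a := (label i).1; set b := (label i).2 => ok.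
exists (a, lift_side c a b); eexists; split; last by [].
rewrite xpair_eqE; have [->|//] := eqVneq a b.
by rewrite orbT addbT; case: lift_side.
Qed.

Lemma edge_rel_adjH : edge_rel label_edge =2 adjH e c.
Proof.
have mem := mem_graphH e_sym e_irr e_conn c_unique x0.
move=> x y; apply/existsP/existsP => [[i /eqP eq_i]|[[[a b] g] /andP[]]].
  exists (label i, label_edge i); rewrite /= eq_i eqxx andbT.
  by rewrite [label i]surjective_pairing mem label_okP -eq_i eqxx.
rewrite mem => /andP[ok /eqP-> /= /eqP eq_g].
by exists (var_of ok); rewrite /label_edge label_var_of eq_g.
Qed.

Lemma xedgeE i : xedge K e c (label_edge i) = 'X_i.
Proof.
have mem := mem_graphH e_sym e_irr e_conn c_unique x0.
rewrite /xedge; case: pickP => [[[a b] g]|none].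
  rewrite mem /= => /andP[/andP[ok /eqP->] /eqP eq_i].
  rewrite (xvarE ok); congr 'X_[U_(_)]; apply: label_edge_inj.
  by rewrite {1}/label_edge label_var_of.
have := none (label i, label_edge i).
by rewrite /= eqxx [label i]surjective_pairing mem label_okP eqxx.
Qed.

Local Notation vdeg := (vertex_degrees label_edge).

Lemma rung_ok a : label_ok e a a. Proof. by rewrite /label_ok eqxx. Qed.
Lemma edge_ok a b : e a b -> label_ok e a b.
Proof. by rewrite /label_ok => ->; rewrite orbT. Qed.
Lemma edge_okC a b : e a b -> label_ok e b a.
Proof. by rewrite e_sym; apply: edge_ok. Qed.

Local Notation rung a := (var_of (rung_ok a)).

Lemma lift_pair_mem a b x : a != b ->
  ((x \in lift_edge c a a) + (x \in lift_edge c b b) =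
   (x \in lift_edge c a b) + (x \in lift_edge c b a))%N.
Proof.
move=> neq; have sideC := lift_sideC c_unique x0.
rewrite !(lift_edge_refl e_sym e_irr c_unique x0) /lift_edge.
have := sideC _ _ neq; rewrite [b == a]eq_sym (negPf neq) !orbF => sba.
have neq' : b != a by rewrite eq_sym.
have sab := sideC _ _ neq'.
rewrite sba sab; case: x => r s; rewrite !in_set2 !xpair_eqE.
have [->|ra] := eqVneq r a; first by rewrite (negPf neq); case: s; case: (lift_side c a b).
by case: (r == b); case: s; case: (lift_side c b a).
Qed.

(** The two rungs and the two lifts of an edge of G form a square of H. *)
Lemma square_degrees a b (eab : e a b) :
  vdeg (U_(rung a) + U_(rung b))%MM =
  vdeg (U_(var_of (edge_ok eab)) + U_(var_of (edge_okC eab)))%MM.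
Proof.
have neq : a != b by apply: contraTneq eab => ->; rewrite e_irr.
apply/vertex_degreesP => x; rewrite !degree_atD !degree_atU /label_edge !label_var_of /=.
exact: lift_pair_mem.
Qed.

Lemma fgenE a b (eab : e a b) : fgen K e a b =
  'X_[U_(rung a) + U_(rung b)] - 'X_[U_(var_of (edge_ok eab)) + U_(var_of (edge_okC eab))].
Proof. by rewrite /fgen (xvarE (rung_ok a)) (xvarE (rung_ok b)) (xvarE (edge_ok eab)) (xvarE
  (edge_okC eab)) !mpolyXD. Qed.

Lemma fgen_PG a b : e a b -> PG (fgen K e a b).
Proof.
move=> eab; case: (ltngtP a b) => [lt|lt|/ord_inj eq_ab]; last by rewrite eq_ab e_irr in eab.
  by apply: mem_ideal_gen; exists a, b.
apply: mem_ideal_gen; exists b, a; rewrite e_sym; split=> //.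
by rewrite /fgen [xvar K e a a * _]mulrC [xvar K e a b * _]mulrC.
Qed.

Lemma toric_map_PG (p : S) : PG p -> toric_map label_edge p = 0.
Proof.
apply: toric_map_ideal => _ [a [b [_ eab ->]]].
by rewrite (fgenE eab) toric_mapB !toric_mapX square_degrees subrr.
Qed.

Definition opposite_vars (i j : 'I_N) :=
  ((label i).1 != (label i).2) && (label j == ((label i).2, (label i).1)).

Definition normal_mon (m : mon) :=
  [forall i, forall j, opposite_vars i j ==> (m i == 0%N) || (m j == 0%N)].

Definition off_diagonal (i : 'I_N) := (label i).1 != (label i).2.

Definition off_degree (m : mon) : nat := \sum_(i | off_diagonal i) m i.

Lemma off_degreeD m m' : off_degree (m + m')%MM = (off_degree m + off_degree m')%N.
Proof. by rewrite -big_split; apply: eq_bigr => i _; rewrite mnmDE. Qed.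

Lemma off_degreeU i : off_degree U_(i)%MM = off_diagonal i.
Proof.
rewrite /off_degree; case: (boolP (off_diagonal i)) => od.
  rewrite (bigD1 i) //= mnm1E eqxx big1 // => j /andP[_ neq].
  by rewrite mnm1E eq_sym (negPf neq).
by rewrite big1 // => j odj; rewrite mnm1E; case: eqP od => // ->; rewrite odj.
Qed.

(** Each replacement of [x_ab * x_ba] by [x_aa * x_bb] decreases the degree in the
    variables off the diagonal. *)
Lemma normal_form m :
  exists m0, [/\ normal_mon m0, PG ('X_[m] - 'X_[m0] : S) & vdeg m0 = vdeg m].
Proof.
have [k] := ubnP (off_degree m); elim: k => // k IHk in m * => bound.
have [nm|] := boolP (normal_mon m).
  by exists m; split=> //; rewrite subrr; apply: ideal_gen0.
rewrite negb_forall => /existsP[i]; rewrite negb_forall => /existsP[j].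
rewrite negb_imply negb_or => /andP[/andP[neq /eqP lj] /andP[mi mj]].
have eab : e (label i).1 (label i).2.
  by have := label_okP i; rewrite /label_ok (negPf neq).
have iE : var_of (edge_ok eab) = i.
  by apply: label_inj; rewrite label_var_of -surjective_pairing.
have jE : var_of (edge_okC eab) = j by apply: label_inj; rewrite label_var_of lj.
have neq_ij : i != j.
  apply: contraNneq neq => ij; move: lj; rewrite -ij.
  by rewrite [LHS]surjective_pairing => -[_ <-].
have dvd : (U_(i) + U_(j) <= m)%MM.
  apply/mnm_lepP => l; rewrite mnmDE !mnm1E.
  have [<-|_] := eqVneq i l; first by rewrite [j == i]eq_sym (negPf neq_ij) addn0 lt0n.
  by rewrite add0n; case: eqP => // <-; rewrite lt0n.
set a := (label i).1 in eab iE jE; set b := (label i).2 in eab iE jE.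
pose r := (m - (U_(i) + U_(j)))%MM.
have mE : m = (r + (U_(i) + U_(j)))%MM by rewrite submK.
pose m' := (r + (U_(rung a) + U_(rung b)))%MM.
have off_rung x : off_diagonal (rung x) = false by rewrite /off_diagonal label_var_of /= eqxx.
have [|m0 [nm0 Im0 dm0]] := IHk m'.
  rewrite -ltnS; apply: leq_trans bound; rewrite ltnS mE !off_degreeD !off_degreeU !off_rung.
  by have odi : off_diagonal i := neq; rewrite odi ltn_add2l.
have dm' : vdeg m' = vdeg m.
  by rewrite mE /m' vertex_degreesD (square_degrees eab) iE jE -vertex_degreesD.
exists m0; split=> //; last by rewrite dm0.
rewrite -(subrK 'X_[m'] 'X_[m]) -addrA; apply: ideal_genD Im0.
have -> : 'X_[m] - 'X_[m'] = (- 'X_[r]) * fgen K e a b.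
  by rewrite (fgenE eab) iE jE mE /m' ![in LHS]mpolyXD !mpolyXD mulNr -mulrN opprB mulrBr.
by apply/ideal_genM/fgen_PG.
Qed.

Section Functional.
Variable psi : 'I_n -> int.

(** The opposite signs on the two sides make the functional vanish on rungs. *)
Definition lifted_functional (x : 'I_n * bool) : int := (-1) ^+ x.2 * psi x.1.

(** Double counting of the pairs of a vertex and an edge containing it. *)
Lemma functional_degrees (m : mon) :
  \sum_x lifted_functional x *+ degree_at label_edge m x =
  \sum_i (\sum_(x in label_edge i) lifted_functional x) *+ m i.
Proof.
under eq_bigr do rewrite -sumrMnr.
rewrite exchange_big; apply: eq_bigr => i _ /=; rewrite -sumrMnl.
rewrite [RHS]big_mkcond; apply: eq_bigr => x _; case: (x \in _); rewrite ?muln1 ?muln0 ?mulr0n //.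
Qed.

Lemma functional_rung i : ~~ off_diagonal i ->
  \sum_(x in label_edge i) lifted_functional x = 0.
Proof.
rewrite negbK => /eqP eq_ab; rewrite /label_edge -eq_ab.
rewrite (lift_edge_refl e_sym e_irr c_unique x0) big_setU1 ?big_set1; last first.
  by rewrite in_set1 xpair_eqE andbF.
by rewrite /lifted_functional /= mul1r mulN1r subrr.
Qed.

Lemma functional_edge i : off_diagonal i ->
  let a := (label i).1 in let b := (label i).2 in
  \sum_(x in label_edge i) lifted_functional x =
  (-1) ^+ lift_side c a b * (psi a + (-1) ^+ twisted c a b * psi b).
Proof.
move=> neq a b; rewrite /label_edge /lift_edge (negPf neq) orbF -/a -/b.
rewrite big_setU1 ?big_set1; last by rewrite in_set1 xpair_eqE (negPf neq).
by rewrite /lifted_functional /= signr_addb mulrDr mulrA.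
Qed.

End Functional.

(** Pair the degrees with the lift of the functional of [edge_functional] for the
    edge of [i] and [j]: only the exponents of these two variables remain, with
    opposite coefficients. *)
Lemma degrees_difference (m m' : mon) i j : opposite_vars i j -> vdeg m = vdeg m' ->
  (m i + m' j = m' i + m j)%N.
Proof.
move=> /andP[neq /eqP lj] /vertex_degreesP eq_d.
set a := (label i).1 in neq lj; set b := (label i).2 in neq lj.
have eab : e a b by have := label_okP i; rewrite /label_ok (negPf neq).
have [f f_proper] := e_bip.
have [psi psiP] := edge_functional e_sym e_irr c_unique x0 f_proper eab.
pose w l := \sum_(x in label_edge l) lifted_functional psi x.
have odi : off_diagonal i by [].
have odj : off_diagonal j by rewrite /off_diagonal lj eq_sym.
have neq_ij : j != i.
  by apply: contraNneq neq => ji; move: lj; rewrite ji [label i]surjective_pairing => -[_ <-].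
have wE l : l != i -> l != j -> w l = 0.
  move=> li lj'; rewrite /w; have [od|/functional_rung->//] := boolP (off_diagonal l).
  rewrite functional_edge //.
  have el : e (label l).1 (label l).2 by have := label_okP l; rewrite /label_ok (negPf od).
  suff eq0 : psi (label l).1 + (-1) ^+ twisted c (label l).1 (label l).2 * psi (label l).2 == 0.
    by rewrite (eqP eq0) mulr0.
  rewrite psiP //; apply/eqP => /eq_set2[][E1 E2]; [case/eqP: li|case/eqP: lj']; apply: label_inj.
    by rewrite [LHS]surjective_pairing E1 E2 -surjective_pairing.
  by rewrite [LHS]surjective_pairing E1 E2 lj.
have wi : w i != 0.
  rewrite /w functional_edge // mulf_neq0 ?signr_eq0 //.
  by rewrite psiP // eqxx.
have wj : w j = - w i.
  rewrite /w !functional_edge // lj /= -/a -/b [twisted c b a]twistedC.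
  have := lift_sideC c_unique x0 neq; rewrite [twisted c b a]twistedC.
  by case: (twisted c a b); case: (lift_side c a b); case: (lift_side c b a) => //= _; lia.
have key (m0 : mon) : \sum_x lifted_functional psi x *+ degree_at label_edge m0 x =
    w i * ((m0 i)%:Z - (m0 j)%:Z).
  transitivity (\sum_l w l *+ m0 l); first exact: functional_degrees.
  rewrite (bigD1 i) //= (bigD1 j) //= [X in _ + (_ + X)]big1 ?addr0; last first.
    by move=> l /andP[li lj']; rewrite wE // mul0rn.
  by rewrite wj mulNrn mulrBr -[Posz (m0 i)]natz -[Posz (m0 j)]natz !mulr_natr.
have : w i * ((m i)%:Z - (m j)%:Z) = w i * ((m' i)%:Z - (m' j)%:Z).
  by rewrite -!key; apply: eq_bigr => x _; rewrite eq_d.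
by move/(mulfI wi); lia.
Qed.

(** For a normal monomial one of the exponents of [x_ab], [x_ba] is 0, so they are
    both known from their difference; the exponents of the diagonal variables
    are then read off from the degrees. *)
Lemma normal_form_unique (m m' : mon) : normal_mon m -> normal_mon m' ->
  vdeg m = vdeg m' -> m = m'.
Proof.
move=> nm nm' eq_d.
have off_eq i : off_diagonal i -> m i = m' i.
  move=> od; have eab : e (label i).1 (label i).2.
    by have := label_okP i; rewrite /label_ok (negPf od).
  pose j := var_of (edge_okC eab).
  have opp : opposite_vars i j by rewrite /opposite_vars label_var_of eqxx andbT.
  have := degrees_difference opp eq_d.
  move/forallP/(_ i)/forallP/(_ j)/implyP/(_ opp): nm.
  move/forallP/(_ i)/forallP/(_ j)/implyP/(_ opp): nm'.
  by case/orP=> /eqP-> /orP[]/eqP->; lia.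
apply/mnmP => i; have [/off_eq//|od] := boolP (off_diagonal i).
pose x := vtx (label i).1; have := (vertex_degreesP _ _ _).2 eq_d x.
have eq_ab : (label i).1 = (label i).2 by apply/eqP; rewrite negbK in od.
have edge_i : label_edge i = [set x; wtx (label i).1].
  by rewrite /label_edge -eq_ab (lift_edge_refl e_sym e_irr c_unique x0).
rewrite /degree_at (bigD1 i) //= [RHS](bigD1 i) //= edge_i set21 !muln1.
have -> : (\sum_(l | l != i) m l * (x \in label_edge l) =
           \sum_(l | l != i) m' l * (x \in label_edge l))%N.
  apply: eq_bigr => l li; have [/off_eq->//|od'] := boolP (off_diagonal l).
  have eq_ab' : (label l).1 = (label l).2 by apply/eqP; rewrite negbK in od'.
  have -> : label_edge l = [set vtx (label l).1; wtx (label l).1].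
    by rewrite /label_edge -eq_ab' (lift_edge_refl e_sym e_irr c_unique x0).
  rewrite in_set2 !xpair_eqE andbF orbF eqxx andbT.
  case: eqP => [eq_l|_]; last by rewrite !muln0.
  case/eqP: li; apply: label_inj.
  by rewrite [LHS]surjective_pairing [RHS]surjective_pairing -eq_ab -eq_ab' eq_l.
by move/addIn.
Qed.

Lemma binomial_PG (m m' : mon) : vdeg m = vdeg m' -> PG ('X_[m] - 'X_[m'] : S).
Proof.
move=> eq_d; have [m0 [nm0 Im0 d0]] := normal_form m.
have [m1 [nm1 Im1 d1]] := normal_form m'.
have eq01 : m0 = m1 by apply: normal_form_unique; rewrite // d0 d1.
rewrite -eq01 in Im1.
have -> : 'X_[m] - 'X_[m'] = ('X_[m] - 'X_[m0]) - ('X_[m'] - 'X_[m0]) :> S.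
  by rewrite opprB addrA subrK.
exact: ideal_genB Im0 Im1.
Qed.

(** * The binomials of the even cycles *)

Lemma odd_walks_meet (w1 w2 : seq ('I_n * bool)) :
  cycle (edge_rel label_edge) w1 -> cycle (edge_rel label_edge) w2 ->
  odd (size w1) -> odd (size w2) ->
  exists x y, [/\ x != y, x \in w1, y \in w1, x \in w2 & y \in w2].
Proof.
rewrite !(eq_cycle edge_rel_adjH); have [f f_proper] := e_bip.
exact: odd_walks_share f_proper _ _.
Qed.

Definition even_cycle (u : seq ('I_n * bool)) :=
  is_cycle (edge_rel label_edge) u && ~~ odd (size u).

Definition cycle_pair (u : seq ('I_n * bool)) : mon * mon :=
  (alt_mon label_edge false (cycle_edges u), alt_mon label_edge true (cycle_edges u)).

(** Cycles have distinct vertices, so bounding their length keeps them all. *)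
Definition cycle_pairs : seq (mon * mon) :=
  [seq cycle_pair u
    | u : {bseq #|{: 'I_n * bool}| of 'I_n * bool} in
        [pred u : {bseq #|{: 'I_n * bool}| of 'I_n * bool} | even_cycle u]].

Lemma cycle_pairsP ab :
  reflect (exists2 u, even_cycle u & ab = cycle_pair u) (ab \in cycle_pairs).
Proof.
apply: (iffP idP) => [/imageP[u ev ->]|[u ev ->]]; first by exists (u : seq _).
have size_u : (size u <= #|{: 'I_n * bool}|)%N.
  by have /andP[/and3P[_ /card_uniqP <- _] _] := ev; apply: max_card.
by apply/imageP; exists (Bseq size_u).
Qed.

Lemma cycle_binomialE u : even_cycle u ->
  cycle_binomial K e c u = 'X_[(cycle_pair u).1] - 'X_[(cycle_pair u).2].
Proof.
move=> /andP[cu eu]; rewrite /cycle_binomial /=.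
rewrite -(prod_cycle_edges label_edge_inj (x0, true) cu eu (F := xedge K e c) false xedgeE).
rewrite -(prod_cycle_edges label_edge_inj (x0, true) cu eu (F := xedge K e c) true xedgeE).
by congr (_ - _); apply: eq_bigl => j; case: (odd j).
Qed.

Lemma even_cycleE u : even_cycle u = is_cycle (adjH e c) u && ~~ odd (size u).
Proof. by rewrite /even_cycle /is_cycle (eq_cycle edge_rel_adjH). Qed.

Lemma cycle_pairs_sym a b : (a, b) \in cycle_pairs -> (b, a) \in cycle_pairs.
Proof.
move=> /cycle_pairsP[u /andP[cu eu] [-> ->]]; apply/cycle_pairsP; exists (rot 1 u).
  by rewrite /even_cycle size_rot eu andbT; case: (alt_mon_rot label_edge_inj true cu eu).
rewrite /cycle_pair (alt_mon_rot label_edge_inj true cu eu).2.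
by rewrite (alt_mon_rot label_edge_inj false cu eu).2.
Qed.

Lemma universal_groebner_basis_PG p :
  up_to_sign (universal_groebner_basis (@PG K n e)) p <->
  exists a b, (a, b) \in cycle_pairs /\ p = 'X_[a] - 'X_[b].
Proof.
apply: (@universal_groebner_basis_circuits _ _ #|{: 'I_n * bool}| _ vdeg).
- exact: ideal_genB.
- exact: vertex_degreesD.
- by move=> q m /toric_map_PG; apply: toric_partner.
- move=> a b /cycle_pairsP[u /andP[cu eu] [-> ->]]; apply: binomial_PG.
  exact: degree_alt_mon label_edge_inj (x0, true) _ cu eu.
- move=> a b /cycle_pairsP[u /andP[cu eu] [-> ->]].
  exact: degree_alt_mon label_edge_inj (x0, true) _ cu eu.
- move=> a b /cycle_pairsP[u /andP[cu eu] [-> ->]].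
  exact: alt_mon_neq label_edge_inj (x0, true) _ cu eu.
- move=> m m' neq eq_d.
  have [u [cu eu um um']] := conformal_cycle label_edge_inj label_edge_pair odd_walks_meet neq
    eq_d.
  exists (cycle_pair u).1, (cycle_pair u).2; split=> //.
  by apply/cycle_pairsP; exists u => //; rewrite /even_cycle cu.
- exact: cycle_pairs_sym.
move=> a b a' b' /cycle_pairsP[u /andP[cu eu] [-> ->]] /cycle_pairsP[u' /andP[cu' eu'] [-> ->]].
exact: (alt_mon_circuit label_edge_inj cu eu cu' eu').
Qed.

End PrincipalMinors.

Theorem theorem3p12 (K : fieldType) (n : nat) (e : rel 'I_n) (c : seq 'I_n)
    (e_sym : ssrbool.symmetric e) (e_irr : irreflexive e)
    (e_conn : connected_graph e) (e_bip : bipartite e)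
    (c_uniq : unique_cycle e c) (p : polyS K e) :
  up_to_sign (universal_groebner_basis (@PG K n e)) p
  <->
  up_to_sign (fun q : polyS K e =>
    exists u : seq ('I_n * bool),
      [/\ is_cycle (adjH e c) u, ~~ odd (size u)
        & q = cycle_binomial K e c u]) p.
Proof.
have [x0 _] : exists x0, x0 \in c.
  by case: (c_uniq) => /and3P[]; case: (c) => // x s; exists x; rewrite mem_head.
have ugb := universal_groebner_basis_PG e_sym e_irr e_conn e_bip c_uniq x0.
have cycE u : is_cycle (adjH e c) u -> ~~ odd (size u) -> even_cycle e c u.
  by move=> cu eu; rewrite (even_cycleE e_sym e_irr e_conn c_uniq x0) cu.
have binE := cycle_binomialE K e_sym e_irr e_conn c_uniq x0.
rewrite ugb; split=> [[a [b [/cycle_pairsP[u ev [-> ->]] ->]]]|].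
  left; exists u; have := ev; rewrite (even_cycleE e_sym e_irr e_conn c_uniq x0) => /andP[cu eu].
  by split=> //; rewrite binE.
case=> -[u [cu eu]] pE; have ev := cycE u cu eu.
  exists (cycle_pair e c u).1, (cycle_pair e c u).2; split; first by apply/cycle_pairsP; exists u.
  by rewrite pE binE.
exists (cycle_pair e c u).2, (cycle_pair e c u).1; split.
  by apply: (cycle_pairs_sym c_uniq x0); apply/cycle_pairsP; exists u.
by rewrite -[p]opprK pE binE // opprB.
Qed.
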